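(* Let $G$ be a connected simple graph of order $n\geq 5$. Then: (a) $m(\partial^L_1(G))=3$ and $\partial^L_{n-1}(G)=n$ with multiplicity $n-4$ (i.e. $n$ is a distance Laplacian eigenvalue of $G$ of multiplicity exactly $n-4$) if and only if $G\cong K_{4,1,\dots,1}$ or $G\cong K_{2,2,2,1,\dots,1}$. (b) $m(\partial^L_1(G))=2$ and $\partial^L_{n-1}(G)=n$ with multiplicity $n-4$ if and only if $G\cong SK_{n,4}+e$ or $G\cong K_{3,2,1,\dots,1}$. (c) $m(\partial^L_1(G))=1$ and $\partial^L_{n-1}(G)=n$ with multiplicity $n-4$ if and only if $G$ is isomorphic to one of the following graphs: $\overline{S_4\cup (n-4)K_1}$, $\overline{C_4\cup (n-4)K_1}$, $\overline{P_4\cup (n-4)K_1}$, $\overline{Ki_{4,3}\cup (n-4)K_1}$, $\overline{S_3\cup K_2\cup (n-5)K_1}$.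
   Context: All graphs are simple. For a connected graph $G$ on vertices $v_1,\dots,v_n$, let $d_{uv}$ be the length of a shortest path between $u$ and $v$, $D(G)=(d_{uv})$ the distance matrix, and $Tr_i=\sum_{u} d_{u v_i}$ the transmission of $v_i$. The distance Laplacian matrix is $D^L(G)=\mathrm{Diag}(Tr_1,\dots,Tr_n)-D(G)$; it is real symmetric positive semidefinite, and its eigenvalues (distance Laplacian eigenvalues), listed with multiplicity, are $\partial^L_1(G)\geq \partial^L_2(G)\geq\dots\geq\partial^L_{n-1}(G)>\partial^L_n(G)=0$. $m(\partial^L_i(G))$ denotes the multiplicity of $\partial^L_i(G)$ as an eigenvalue of $D^L(G)$. $K_m$, $C_m$, $P_m$, $S_m$ are the complete graph, cycle, path and star on $m$ vertices. $K_{t_1,\dots,t_l}$ is the complete multipartite graph with partite classes of sizes $t_1,\dots,t_l$; in $K_{4,1,\dots,1}$, $K_{2,2,2,1,\dots,1}$ and $K_{3,2,1,\dots,1}$ the number of classes of size $1$ (possibly zero) is such that the graph has $n$ vertices in total (so $K_{2,2,2,1,\dots,1}$ occurs only for $n\geq 6$). $SK_{n,\alpha}$ (complete split graph) is the complement of the disjoint union of a clique $K_\alpha$ and $n-\alpha$ isolated vertices. $H+e$ is the graph obtained from $H$ by adding an edge between two non-adjacent vertices (unique up to isomorphism for $H=SK_{n,4}$). The kite $Ki_{n,\omega}$ is obtained from a clique $K_\omega$ and a path $P_{n-\omega}$ by adding an edge between an endpoint of the path and a vertex of the clique; thus $Ki_{4,3}$ is a triangle with one pendant vertex attached. $\overline{H}$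 is the complement of $H$, $\cup$ is disjoint union, and $kK_1$ is $k$ isolated vertices. *)

(* Defs.v *)
From HB Require Import structures.
From mathcomp Require Import all_boot all_order all_algebra.
From mathcomp Require Import polyrcf.

Set Implicit Arguments.
Unset Strict Implicit.
Unset Printing Implicit Defensive.

Import Order.TTheory GRing.Theory Num.Theory.

Record sgraph := SGraph {
  vertex :> finType;
  edge : rel vertex;
  edge_sym : symmetric edge;
  edge_irr : irreflexive edge }.

Definition connected (G : sgraph) : Prop :=
  forall u v : G, connect (@edge G) u v.

Definition isomorphic (G H : sgraph) : Prop :=
  exists f : G -> H, bijective f /\ forall u v : G, edge (f u) (f v) = edge u v.

Notation "G '~=g' H" := (isomorphic G H) (at level 70, no associativity).

(* The simple graph underlying an arbitrary relation: loops are dropped and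
   the direction of the edges is forgotten. *)
Section MkGraph.
Variables (V : finType) (e : rel V).

Definition mk_rel : rel V := [rel u v | (u != v) && (e u v || e v u)].

Lemma mk_rel_sym : symmetric mk_rel.
Proof. by move=> u v; rewrite /mk_rel /= eq_sym orbC. Qed.

Lemma mk_rel_irr : irreflexive mk_rel.
Proof. by move=> u; rewrite /mk_rel /= eqxx. Qed.

Definition mk_graph : sgraph := SGraph mk_rel_sym mk_rel_irr.
End MkGraph.

Definition complete (m : nat) : sgraph := mk_graph (fun _ _ : 'I_m => true).

Definition edgeless (k : nat) : sgraph := mk_graph (fun _ _ : 'I_k => false).

Definition path_graph (m : nat) : sgraph :=
  mk_graph (fun i j : 'I_m => j == i.+1 :> nat).

(* A cycle for m >= 3. *)
Definition cycle_graph (m : nat) : sgraph :=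
  mk_graph (fun i j : 'I_m => j == i.+1 %% m :> nat).

(* The star of order m, with centre 0 and m - 1 leaves. *)
Definition star (m : nat) : sgraph := mk_graph (fun i _ : 'I_m => i == 0 :> nat).

(* The clique is {0, ..., w-1}; the path is w, ..., n-1, whose endpoint w is
   attached to the clique vertex w-1. *)
Definition kite (n w : nat) : sgraph :=
  mk_graph (fun i j : 'I_n => (i < w) && (j < w) || (j == i.+1 :> nat)).

(* Vertices are pairs (class, index in the class). *)
Definition complete_multipartite (ts : seq nat) : sgraph :=
  mk_graph (fun u v : {i : 'I_(size ts) & 'I_(nth 0 ts i)} => tag u != tag v).

Definition complement (G : sgraph) : sgraph :=
  mk_graph (fun u v : G => ~~ edge u v).

Definition disjoint_union (G H : sgraph) : sgraph :=
  mk_graph (fun x y : G + H => match x, y with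
                               | inl u, inl v => edge u v
                               | inr u, inr v => edge u v
                               | _, _ => false
                               end).

Notation "G '\+g' H" := (disjoint_union G H) (at level 50, left associativity).

Definition complete_split (n a : nat) : sgraph :=
  complement (complete a \+g edgeless (n - a)).

Definition add_edge (G : sgraph) (a b : G) : sgraph :=
  mk_graph (fun u v : G => edge u v || (u == a) && (v == b)).

Definition is_plus_edge (G H : sgraph) : Prop :=
  exists a b : H, [/\ a != b, ~~ edge a b & G ~=g add_edge a b].

(* Paths have no repeated vertex, hence fewer than #|G| edges. If u and v are in
   different components, then the value is #|G|, by convention of [find]. *)
Definition dist (G : sgraph) (u v : G) : nat :=
  find (fun k => [exists p : k.-tuple G,
                   [&& path (@edge G) u p, uniq (u :: p) & last u p == v]])
       (iota 0 #|G|).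

Definition transmission (G : sgraph) (v : G) : nat := \sum_(u : G) dist u v.

Local Open Scope ring_scope.

(* The vertices are numbered by [enum_val]. *)
Definition dist_mx (R : rcfType) (G : sgraph) : 'M[R]_#|G| :=
  \matrix_(i, j) (dist (enum_val i) (enum_val j))%:R.

Definition dist_laplacian (R : rcfType) (G : sgraph) : 'M[R]_#|G| :=
  diag_mx (\row_i (transmission (enum_val i))%:R) - dist_mx R G.

Definition eig_mult (R : rcfType) (n : nat) (A : 'M[R]_n) (a : R) : nat :=
  mup a (char_poly A).

(* All the eigenvalues lying in R, repeated according to multiplicity, in
   nonincreasing order; a symmetric A : 'M_n has n of them. *)
Definition spectrum (R : rcfType) (n : nat) (A : 'M[R]_n) : seq R :=
  sort >=%O (flatten [seq nseq (eig_mult A a) a | a <- rootsR (char_poly A)]).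

(* Numbered from 1, for 1 <= i <= #|G|. *)
Definition dL_eig (R : rcfType) (G : sgraph) (i : nat) : R :=
  (spectrum (dist_laplacian R G))`_i.-1.

Definition dL_mult (R : rcfType) (G : sgraph) (i : nat) : nat :=
  eig_mult (dist_laplacian R G) (dL_eig R G i).

(* Main.v *)
Require Import Defs.
From HB Require Import structures.
From mathcomp Require Import all_boot all_order all_fingroup all_algebra.
From mathcomp Require Import polyrcf zify ring lra.

Set Implicit Arguments.
Unset Strict Implicit.
Unset Printing Implicit Defensive.

Import Order.TTheory GRing.Theory Num.Theory.
Local Open Scope ring_scope.

(** Let H be the complement of G and A = D^L(G) - n. Off the diagonal, A is
    - 1 minus the weight d(u, v) - 1, and its rows sum to - n, so A = W - J
    where W is the Laplacian of H with edge weights d(u, v) - 1 > 0. Hence A is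
    symmetric with kernel the vectors of sum zero that are constant along the
    edges of H (kermx_shifted_laplacian), and the multiplicity of n as an
    eigenvalue of D^L(G) is n - rank A (mup_char_poly_sym). It equals n - 4 iff
    rank A = 4, iff a maximal forest of H has three edges.

    Such an H consists of isolated vertices and of a core: a connected graph on
    four vertices, or three vertices joined by two or three edges next to a
    disjoint edge, or three disjoint edges. That makes nine cores
    (core_classification). The combinatorics only uses two bounds on rank A: a
    forest of H with k edges gives k < rank A (rank_shifted_laplacian_ge), and k
    edges whose connected components contain all the edges of H give
    rank A <= k + 1 (rank_shifted_laplacian_le).

    Conversely, if H has one of these cores then it is disconnected, so G has
    diameter two and W is the plain Laplacian of H. The nonzero eigenvalues of
    D^L(G) are then n, with multiplicity n - 4, and n + mu for the three nonzero
    Laplacian eigenvalues mu of the core. These are read off an orthogonal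
    decomposition of the core Laplacian (dL_complement_core), one for each of the
    nine cores. The largest mu is triple for K_4 and 3 K_2, double for K_4 - e
    and K_3 + K_2 (a disjoint union), and simple for the five others. So the
    multiplicity of the largest eigenvalue tells the three families apart.

    Finally, two graphs of the same order whose complements have the same core
    are isomorphic (complement_core_unique), so each graph of the theorem is
    recognised by its core. *)

(** * Characteristic polynomials of low-rank perturbations and symmetric matrices *)

(** Both sides are determinants of block-triangular products of the matrix
    with blocks t, P, Q, 1, multiplied on the right and on the left. *)
Lemma det_sylvester (R : comNzRingType) (m n : nat) (t : R)
    (P : 'M[R]_(m, n)) (Q : 'M[R]_(n, m)) :
  \det (t%:M - P *m Q) * t ^+ n = t ^+ m * \det (t%:M - Q *m P).
Proof.
pose B := block_mx t%:M P Q 1%:M.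
have dB : \det B = \det (t%:M - P *m Q).
  have := det_mulmx B (block_mx 1%:M 0 (- Q) 1%:M).
  rewrite mulmx_block !mulmx1 !mul1mx !mulmx0 !add0r mulmxN subrr.
  by rewrite det_ublock det_lblock !det1 !mulr1 => ->.
have := det_mulmx (block_mx 1%:M 0 (- Q) t%:M) B.
rewrite mulmx_block !mul1mx !mul0mx !addr0 mulmx1 !mulNmx.
rewrite (scalar_mxC t Q) addNr [- _ + _]addrC.
by rewrite det_ublock det_lblock det1 mul1r !det_scalar dB => ->; rewrite mulrC.
Qed.

Section CharPoly.
Variables (R : rcfType) (n : nat).
Implicit Types A : 'M[R]_n.

Lemma char_poly_sylvester A (a : R) (r : nat) (P : 'M[R]_(n, r))
    (Q : 'M[R]_(r, n)) :
  A - a%:M = P *m Q ->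
  char_poly A * ('X - a%:P) ^+ r =
  ('X - a%:P) ^+ n
    * \det (('X - a%:P)%:M - map_mx polyC (Q *m P)).
Proof.
move=> defA; rewrite map_mxM -det_sylvester; congr (\det _ * _).
rewrite -map_mxM -defA map_mxB map_scalar_mx /= /char_poly_mx.
by rewrite raddfB /= opprB addrA subrK.
Qed.

Lemma mulmx_tr_eq0 (m : nat) (u : 'M[R]_(m, n)) : u *m u^T = 0 -> u = 0.
Proof.
move=> /matrixP uu0; apply/matrixP=> i j; rewrite mxE.
have := uu0 i i; rewrite !mxE => /psumr_eq0P s0.
have /s0/(_ j isT)/eqP : forall k, true -> 0 <= u i k * u^T k i.
  by move=> k _; rewrite mxE -expr2 sqr_ge0.
by rewrite mxE mulf_eq0 orbb => /eqP.
Qed.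

(** The rank factorisation A = P Q of a symmetric matrix over a real field has Q P
    invertible: if u Q P = 0 then u Q is both in the row space of A and
    annihilated by A, hence orthogonal to itself. *)
Lemma row_base_col_base_free A : A^T = A -> row_free (row_base A *m col_base A).
Proof.
move=> symA; apply: inj_row_free => u; rewrite mulmxA => uQP0.
have /submxP[w def_w] : (u *m row_base A <= A)%MS.
  by rewrite (submx_trans (submxMl _ _)) ?eq_row_base.
have wAA0 : w *m A *m A = 0.
  by rewrite -def_w -{3}(mulmx_base A) mulmxA uQP0 mul0mx.
have uQ0 : u *m row_base A = 0.
  by apply: mulmx_tr_eq0; rewrite def_w trmx_mul symA mulmxA wAA0 mul0mx.
by apply: (row_free_inj (row_base_free A)); rewrite uQ0 mul0mx.
Qed.

(** Algebraic and geometric multiplicities agree, without diagonalising: with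
    A - a = P Q the rank factorisation, the determinant identity exchanges P Q
    for Q P, which is invertible and so contributes no factor X - a. *)
Lemma mup_char_poly_sym A (a : R) :
  A^T = A -> mup a (char_poly A) = (n - \rank (A - a%:M)%R)%N.
Proof.
move=> symA; set B := A - a%:M; set r := \rank B.
have symB : B^T = B by rewrite /B linearB /= tr_scalar_mx symA.
have := char_poly_sylvester (esym (mulmx_base B)).
set q := \det _ => defq.
have q_a : q.[a] != 0.
  have : row_base B *m col_base B \in unitmx.
    by rewrite -row_free_unit row_base_col_base_free.
  rewrite unitmxE unitfE; apply: contra_neq.
  rewrite /q -horner_evalE -det_map_mx map_mxB map_scalar_mx /= horner_evalE.
  rewrite hornerXsubC subrr raddf0 sub0r -map_mx_comp /=.
  rewrite (_ : map_mx _ _ = row_base B *m col_base B); last first.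
    by apply/matrixP=> i j; rewrite mxE /= horner_evalE hornerC.
  rewrite -scaleN1r detZ => /eqP; rewrite mulf_eq0 expf_eq0 oppr_eq0 oner_eq0.
  by rewrite andbF => /eqP.
have q0 : q != 0 by apply: contraNneq q_a => ->; rewrite horner0.
have := congr1 (mup a) defq.
rewrite !mupM ?expf_neq0 ?polyXsubC_eq0 ?q0 ?monic_neq0 ?char_poly_monic //.
by rewrite !mup_XsubCX eqxx (@mupNroot _ a q) // addn0 => /(canRL (addnK _)).
Qed.

Lemma spectrum_prod_XsubC A (s : seq R) :
  char_poly A = \prod_(z <- s) ('X - z%:P) -> sorted >=%O s -> spectrum A = s.
Proof.
move=> defA sort_s; rewrite /spectrum.
have p0 : char_poly A != 0 by rewrite monic_neq0 ?char_poly_monic.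
have mem_rootsR b : (b \in rootsR (char_poly A)) = root (char_poly A) b.
  by rewrite -(roots_on_rootsR p0) in_itv.
apply: (@sorted_eq _ >=%O); rewrite ?sort_sorted //.
- by move=> y x z xy yz; apply: le_trans yz xy.
- by move=> x y /andP[] ? ?; apply/le_anti/andP.
- by move=> x y; apply: le_total.
rewrite perm_sort; apply/allP=> a _; apply/eqP => /=.
rewrite -[RHS]mu_prod_XsubC -defA count_flatten -map_comp sumnE big_map.
under eq_bigr => b _ do rewrite /= count_nseq /=.
have [ra | nra] := boolP (root (char_poly A) a); last first.
  rewrite mupNroot // big1_seq // => b /andP[_ rb].
  by case: eqVneq => // ba; case/negP: nra; rewrite -ba -mem_rootsR.
have a_in : a \in rootsR (char_poly A) by rewrite mem_rootsR.
rewrite (big_rem a) //= eqxx mul1n big1_seq ?addn0 // => b /andP[_].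
by rewrite mem_rem_uniq ?uniq_roots // inE => /andP[/negPf -> _].
Qed.
End CharPoly.

(** * Distances *)

(** The edge relation of the complement of G, on the vertices of G. *)
Definition nonadj (G : sgraph) : rel G :=
  fun u v => (u != v) && ~~ edge u v.

Lemma nonadj_sym (G : sgraph) : symmetric (@nonadj G).
Proof. by move=> u v; rewrite /nonadj eq_sym edge_sym. Qed.

Lemma nonadj_neq (G : sgraph) (u v : G) : nonadj u v -> u != v.
Proof. by case/andP. Qed.

Lemma edge_nonadj (G : sgraph) (u v : G) :
  u != v -> edge u v = ~~ nonadj u v.
Proof. by move=> uv; rewrite /nonadj uv negbK. Qed.

Section Dist.
Variable G : sgraph.
Implicit Types u v w : G.

Lemma path_edge_rev u v (k : nat) (p : k.-tuple G) :
  [&& path (@edge G) u p, uniq (u :: p) & last u p == v] ->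
  exists q : k.-tuple G,
    [&& path (@edge G) v q, uniq (v :: q) & last v q == u].
Proof.
case/and3P=> pth unq /eqP last_p.
have sz : size (rev (belast u p)) == k by rewrite size_rev size_belast size_tuple.
have eq_rev : v :: rev (belast u p) = rev (u :: p).
  by rewrite [u :: p]lastI rev_rcons last_p.
exists (Tuple sz); apply/and3P; split=> /=.
- rewrite -last_p rev_path (eq_path (e' := @edge G)) // => x y.
  by rewrite edge_sym.
- by rewrite -[_ && _]/(uniq (_ :: _)) eq_rev rev_uniq.
- by rewrite -[last _ _]/(last v (v :: _)) eq_rev rev_cons last_rcons.
Qed.

Lemma dist_sym u v : dist u v = dist v u.
Proof.
apply: eq_find => k; apply/existsP/existsP => -[p /path_edge_rev[q qP]];
  by exists q.
Qed.

Lemma distxx u : dist u u = 0%N.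
Proof.
have n_gt0 : (0 < #|G|)%N by apply/card_gt0P; exists u.
rewrite /dist -(prednK n_gt0) /=; case: existsP => // -[].
by exists [tuple]; rewrite /= eqxx.
Qed.

Let exists_tuple0 (P : 0.-tuple G -> bool) : [exists p, P p] = P [tuple].
Proof.
by apply/existsP/idP => [[p]|]; [rewrite tuple0 | exists [tuple]].
Qed.

Let exists_tuple1 (P : 1.-tuple G -> bool) :
  [exists p, P p] = [exists w, P [tuple w]].
Proof.
apply/existsP/existsP => [[p Pp]|[w Pw]]; last by exists [tuple w].
case: p Pp => -[|w [|? ?]] // sz Pp; exists w.
by rewrite (_ : [tuple w] = Tuple sz) //; apply: val_inj.
Qed.

Lemma dist_edge u v : edge u v -> dist u v = 1%N.
Proof.
move=> uv; have neq_uv : u != v.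
  by apply: contraTneq uv => ->; rewrite edge_irr.
have : (1 < #|G|)%N by rewrite (cardD1 u) (cardD1 v) !inE eq_sym neq_uv.
rewrite /dist; case: #|G| => [|[|m]] //= _.
rewrite exists_tuple0 exists_tuple1 /= (negPf neq_uv).
case: existsP => // -[]; exists v.
by rewrite /= uv inE neq_uv eqxx.
Qed.

(** This also holds for vertices in different components, where the distance
    is the order of G. *)
Lemma dist_nonadj u v : nonadj u v -> (1 < dist u v)%N.
Proof.
move=> /andP[neq_uv uv].
have : (1 < #|G|)%N by rewrite (cardD1 u) (cardD1 v) !inE eq_sym neq_uv.
rewrite /dist; case: #|G| => [|[|m]] //= _.
rewrite exists_tuple0 exists_tuple1 /= (negPf neq_uv).
case: existsP => // -[w /=]; rewrite andbT => /and3P[uw _ /eqP wv].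
by rewrite -wv uw in uv.
Qed.

Lemma dist_common_neighbor u v w :
  nonadj u v -> edge u w -> edge w v -> dist u v = 2%N.
Proof.
move=> nuv uw wv; have := dist_nonadj nuv; case/andP: nuv => neq_uv _.
have neq_wu : w != u by apply: contraTneq uw => ->; rewrite edge_irr.
have neq_wv : w != v by apply: contraTneq wv => ->; rewrite edge_irr.
have : (2 < #|G|)%N.
  rewrite (cardD1 u) (cardD1 v) (cardD1 w) !inE.
  by rewrite (eq_sym v) neq_uv neq_wv neq_wu.
rewrite /dist; case: #|G| => [|[|[|m]]] //= _.
do 2![case: existsP => //= _]; case: existsP => //= -[]; exists [tuple w; v].
by rewrite /= uw wv !inE (eq_sym u w) (negPf neq_wu) neq_uv neq_wv eqxx.
Qed.
End Dist.

(** * The eigenvalue n of the distance Laplacian *)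

Section Rank.
Variables (R : rcfType) (G : sgraph).
Local Notation n := #|G|.

Definition shifted_laplacian : 'M[R]_n := dist_laplacian R G - n%:R%:M.
Local Notation A := shifted_laplacian.

Lemma sum_enum_val (V : nmodType) (F : G -> V) :
  \sum_(u : G) F u = \sum_(i < n) F (enum_val i).
Proof. by rewrite -(big_enum_val (A := G)). Qed.

(* The weight of the pair i, j; it is - 1 when i = j, where it is always
   multiplied by zero. *)
Let wt (i j : 'I_n) : R := (dist (enum_val i) (enum_val j))%:R - 1.

Lemma shifted_laplacian_sym : A^T = A.
Proof.
apply/matrixP=> i j; rewrite !mxE dist_sym ![j == i]eq_sym.
by case: eqVneq => [->|].
Qed.

(** The decomposition A = W - J in terms of its action on vectors. *)
Lemma mul_shifted_laplacian (m : nat) (X : 'M[R]_(n, m)) i l :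
  (A *m X) i l = \sum_j wt i j * (X i l - X j l) - \sum_j X j l.
Proof.
rewrite !mulmxBl mul_diag_mx mul_scalar_mx !mxE /transmission natr_sum.
rewrite sum_enum_val mulr_suml mulr_natl -[X in _ *+ X]card_ord -sumr_const.
rewrite -!sumrB; apply: eq_bigr => j _.
by rewrite mxE dist_sym /wt; ring.
Qed.

Let wt_sym i j : wt i j = wt j i.
Proof. by rewrite /wt dist_sym. Qed.

Let wt_mul_sqr_ge0 i j (x : 'I_n -> R) : 0 <= wt i j * (x i - x j) ^+ 2.
Proof.
case: (eqVneq i j) => [->|neq_ij]; first by rewrite subrr expr0n mulr0.
apply: mulr_ge0; last exact: sqr_ge0.
have neq_uv : enum_val i != enum_val j by rewrite (inj_eq enum_val_inj).
rewrite /wt subr_ge0 ler1n lt0n.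
have [uv|nuv] := boolP (edge (enum_val i) (enum_val j)).
  by rewrite dist_edge.
have /dist_nonadj/ltnW : nonadj (enum_val i) (enum_val j) by apply/andP.
by rewrite lt0n.
Qed.

Definition const_on (m : nat) (X : 'M[R]_(n, m)) (u v : G) :=
  row (enum_rank u) X == row (enum_rank v) X.

(** If A x = 0 then x has sum zero, so W x = 0, and the energy
    x^T W x, half the sum of the w_uv (x_u - x_v)^2, vanishes term by term;
    the weights are positive exactly on the edges of the complement. The columns
    of X play the role of x. *)
Lemma kermx_shifted_laplacian (m : nat) (X : 'M[R]_(n, m)) :
  A *m X = 0 <->
  const_mx 1 *m X = 0 :> 'rV_m /\ (forall u v, nonadj u v -> const_on X u v).
Proof.
have sum0E : const_mx 1 *m X = 0 :> 'rV_m <-> forall l, \sum_j X j l = 0.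
  split=> [/rowP sX l|sX].
    have := sX l; rewrite !mxE => sl; rewrite -[RHS]sl.
    by apply: eq_bigr => j _; rewrite mxE mul1r.
  apply/rowP=> l; rewrite mxE [RHS]mxE -[RHS](sX l).
  by apply: eq_bigr => j _; rewrite mxE mul1r.
split=> [AX0|[/sum0E sX cX]]; last first.
  apply/matrixP=> i l; rewrite mul_shifted_laplacian sX subr0 mxE big1 // => j _.
  have [->|neq_ij] := eqVneq i j; first by rewrite subrr mulr0.
  have neq_uv : enum_val i != enum_val j by rewrite (inj_eq enum_val_inj).
  have [uv|nuv] := boolP (edge (enum_val i) (enum_val j)).
    by rewrite /wt dist_edge // subrr mul0r.
  have /cX/eqP/rowP/(_ l) : nonadj (enum_val i) (enum_val j) by apply/andP.
  by rewrite !enum_valK !mxE => ->; rewrite subrr mulr0.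
have AXE i l : \sum_j wt i j * (X i l - X j l) = \sum_j X j l.
  have := congr1 (fun M : 'M_(_, _) => M i l) AX0.
  by rewrite mul_shifted_laplacian mxE => /eqP; rewrite subr_eq0 => /eqP.
(* Antisymmetry cancels the weighted differences in the sum over all rows. *)
have sX l : \sum_j X j l = 0.
  have anti : \sum_i \sum_j wt i j * (X i l - X j l) = 0.
    apply/eqP; rewrite -[_ == 0](mulrn_eq0 _ 2) mulr2n {2}exchange_big /=.
    rewrite -big_split /= big1 // => i _; rewrite -big_split /= big1 // => j _.
    by rewrite [wt j i]wt_sym; ring.
  move: anti; under eq_bigr => i _ do rewrite AXE.
  rewrite sumr_const card_ord => /eqP; rewrite mulrn_eq0 => /orP[/eqP n0|/eqP //].
  by rewrite big1 // => j; have := ltn_ord j; rewrite {2}n0.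
split; first exact/sum0E.
move=> u v nuv; apply/eqP/rowP=> l; rewrite !mxE.
have energy : \sum_i \sum_j wt i j * (X i l - X j l) ^+ 2 = 0.
  have E1 : \sum_i \sum_j wt i j * (X i l - X j l) * X i l = 0.
    by rewrite big1 // => i _; rewrite -mulr_suml AXE sX mul0r.
  have E2 : \sum_i \sum_j wt i j * (X i l - X j l) * X j l = 0.
    rewrite exchange_big /= -[RHS]oppr0 -[in RHS]E1 -sumrN.
    apply: eq_bigr => i _; rewrite -sumrN; apply: eq_bigr => j _.
    by rewrite [wt j i]wt_sym; ring.
  rewrite -[RHS](subrr 0) -[in X in _ = X - _]E1 -[in X in _ = _ - X]E2 -sumrB.
  apply: eq_bigr => i _.
  by rewrite -sumrB; apply: eq_bigr => j _; ring.
have ge0 i j := wt_mul_sqr_ge0 i j (fun i => X i l).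
have : wt (enum_rank u) (enum_rank v)
         * (X (enum_rank u) l - X (enum_rank v) l) ^+ 2 = 0.
  have row0 : \sum_j wt (enum_rank u) j * (X (enum_rank u) l - X j l) ^+ 2 = 0.
    by apply: (psumr_eq0P _ energy) => // i _; apply: sumr_ge0.
  exact: (psumr_eq0P _ row0).
move/eqP; rewrite mulf_eq0 sqrf_eq0 (subr_eq0 (X _ _)) => /orP[|/eqP //].
rewrite /wt !enum_rankK subr_eq0 -[1]/1%:R eqr_nat => /eqP d1.
by have := dist_nonadj nuv; rewrite d1.
Qed.

(** * Bounding the rank by sets of edges of the complement *)

Definition edge_row (e : G * G) : 'rV[R]_n :=
  delta_mx 0 (enum_rank e.1) - delta_mx 0 (enum_rank e.2).

Fixpoint incidence (es : seq (G * G)) : 'M[R]_(size es, n) :=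
  match es with
  | [::] => 0
  | e :: es' => col_mx (edge_row e) (incidence es')
  end.

Lemma mul_edge_row_eq0 (m : nat) (X : 'M[R]_(n, m)) e :
  (edge_row e *m X == 0) = const_on X e.1 e.2.
Proof. by rewrite /edge_row mulmxBl -!rowE subr_eq0. Qed.

Lemma mul_incidence_eq0 (m : nat) (X : 'M[R]_(n, m)) es :
  (incidence es *m X == 0) = all (fun e => const_on X e.1 e.2) es.
Proof.
elim: es => [|e es IH] /=; first by rewrite mul0mx eqxx.
rewrite -[_ *m X]/(col_mx (edge_row e) (incidence es) *m X) mul_col_mx.
by rewrite -[_ == 0]/(_ == 0 :> 'M_(1 + _, _)) col_mx_eq0 mul_edge_row_eq0 IH.
Qed.

(** The edges es connect u to v; phrased by functions so that it compares
    directly with kernels. *)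
Definition spans (es : seq (G * G)) (u v : G) :=
  forall x : G -> R, (forall e, e \in es -> x e.1 = x e.2) -> x u = x v.

(** The rows of A lie in the span of the all-one row and of the rows of es, since
    every vector annihilated by these is annihilated by A. *)
Lemma rank_shifted_laplacian_le (es : seq (G * G)) :
  (forall u v, nonadj u v -> spans es u v) -> (\rank A <= (size es).+1)%N.
Proof.
move=> sp; set C := col_mx (const_mx 1 : 'rV[R]_n) (incidence es).
suff sAC : (A <= C)%MS by rewrite (leq_trans (mxrankS sAC)) ?rank_leq_row.
have /eqP := mulmx_coker C; rewrite submxE mul_col_mx col_mx_eq0.
case/andP=> /eqP X1 /[!mul_incidence_eq0]/allP Xes.
apply/eqP/kermx_shifted_laplacian; split=> // u v /sp spuv.
move: (cokermx C) Xes => X Xes; apply/eqP/rowP=> l; rewrite !mxE.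
apply: (spuv (fun w => X (enum_rank w) l)) => e /Xes/eqP/rowP/(_ l).
by rewrite !mxE.
Qed.

(** Edges of the complement listed so that each one, read from the end of the
    list, has a second endpoint that is a new vertex; every forest has such an
    ordering. *)
Fixpoint growing (es : seq (G * G)) : bool :=
  match es with
  | [::] => true
  | e :: es' =>
    [&& nonadj e.1 e.2, all (fun e' => (e.2 != e'.1) && (e.2 != e'.2)) es'
      & growing es']
  end.

Lemma incidence_mul_const es : incidence es *m const_mx 1 = 0 :> 'cV_ _.
Proof.
apply/eqP; rewrite mul_incidence_eq0; apply/allP=> e _.
by apply/eqP/rowP=> l; rewrite !mxE.
Qed.

(** The test vector x separates the row r from the row space of B. *)
Lemma row_free_col_mx (k : nat) (r : 'rV[R]_n) (B : 'M[R]_(k, n)) (x : 'cV_n) :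
  row_free B -> B *m x = 0 -> r *m x != 0 -> row_free (col_mx r B).
Proof.
move=> free_B Bx rx; apply: inj_row_free => w.
rewrite -[w]hsubmxK mul_row_col; set a := lsubmx w; set b := rsubmx w => w0.
have a0 : a = 0.
  have := congr1 (mulmx^~ x) w0; rewrite mulmxDl -!mulmxA Bx mulmx0 addr0.
  rewrite [a]mx11_scalar mul_scalar_mx mul0mx => /eqP.
  by rewrite scaler_eq0 (negPf rx) orbF => /eqP ->; rewrite raddf0.
move: w0; rewrite a0 mul0mx add0r => b0.
by rewrite (row_free_inj free_B (etrans b0 (esym (mul0mx _ _)))) row_mx0.
Qed.

(** The indicator of the new endpoint is the test vector for the head of the
    list. *)
Lemma growing_row_free es : growing es -> row_free (incidence es).
Proof.
elim: es => [|e es IH] /=; first by rewrite /row_free mxrank0.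
case/and3P=> /andP[neq_e _] new /IH free_es.
apply: (row_free_col_mx (x := delta_mx (enum_rank e.2) 0)) => //.
  apply/eqP; rewrite mul_incidence_eq0; apply: sub_all new => e' /andP[ne1 ne2].
  apply/eqP/rowP=> l; rewrite !mxE !(inj_eq enum_rank_inj).
  by rewrite ![_ == e.2]eq_sym (negPf ne1) (negPf ne2).
apply/eqP=> /rowP/(_ 0)/eqP; rewrite mulmxBl -!rowE !mxE !eqxx.
by rewrite (inj_eq enum_rank_inj) (negPf neq_e) sub0r oppr_eq0 oner_eq0.
Qed.

(** The rows of a growing list and the all-one row are independent, as the latter
    is not orthogonal to the all-one vector, and they vanish on the kernel of A. *)
Lemma rank_shifted_laplacian_ge (es : seq (G * G)) :
  (0 < n)%N -> growing es -> ((size es).+1 <= \rank A)%N.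
Proof.
move=> n_gt0 gr; set C := col_mx (const_mx 1 : 'rV[R]_n) (incidence es).
suff [free_C sCA] : row_free C /\ (C <= A)%MS.
  by rewrite -[(size es).+1](eqP free_C) mxrankS.
split.
  apply: (row_free_col_mx (x := const_mx 1)); first exact: growing_row_free.
    exact: incidence_mul_const.
  apply/eqP=> /rowP/(_ 0)/eqP; rewrite !mxE.
  under eq_bigr => k _ do rewrite !mxE mulr1.
  by rewrite sumr_const card_ord pnatr_eq0 -leqn0 leqNgt n_gt0.
have /kermx_shifted_laplacian[X1 X2] := mulmx_coker A.
rewrite submxE mul_col_mx X1 col_mx_eq0 eqxx mul_incidence_eq0 /=.
elim: es gr {C} => //= e es IH /and3P[ne _ /IH ->].
by rewrite X2.
Qed.
End Rank.

(** * Graphs whose complement has a maximal forest with three edges *)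

(** The complement of G is isomorphic to K plus isolated vertices. *)
Definition complement_core (K G : sgraph) : Prop :=
  exists f : K -> G,
    [/\ injective f, forall i j, nonadj (f i) (f j) = edge i j
      & forall u v, nonadj u v -> u \in codom f].

(** The complete graph on four vertices minus the edge between 0 and 1. *)
Definition diamond : sgraph := mk_graph (fun i j : 'I_4 => (i < j) && (1 < j))%N.

Definition matching3 : sgraph := complete 2 \+g complete 2 \+g complete 2.

(** A core is given by two parallel lists of vertices, so that checking
    adjacencies is a computation. *)
Lemma complement_core_of_seq (K G : sgraph) (x0 : G) (s : seq G) (t : seq K) :
  size s = size t -> uniq s -> uniq t -> (forall k, k \in t) ->
  pairwise (fun x y => nonadj x.1 y.1 == edge x.2 y.2) (zip s t) ->
  (forall u v, nonadj u v -> u \in s) -> complement_core K G.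
Proof.
move=> eq_sz uniq_s uniq_t all_t pw sup.
have lt_s k : (index k t < size s)%N by rewrite eq_sz index_mem.
pose f k := nth x0 s (index k t); exists f; split.
- move=> i j /eqP; rewrite nth_uniq // => /eqP eq_ij.
  by rewrite -[i](nth_index i (all_t i)) eq_ij nth_index.
- have lt_edge i j : (index i t < index j t)%N -> nonadj (f i) (f j) = edge i j.
    move=> lt_ij; have /pairwiseP-/(_ (x0, i)) := pw.
    move=> /(_ (index i t) (index j t)); rewrite !inE size_zip eq_sz minnn.
    rewrite !index_mem => /(_ (all_t i) (all_t j) lt_ij) /eqP.
    by rewrite !nth_zip // !nth_index.
  move=> i j; case: (ltngtP (index i t) (index j t)) => [||eq_ij].
  + exact: lt_edge.
  + by rewrite nonadj_sym edge_sym; apply: lt_edge.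
  + have <- : i = j by rewrite -[i](nth_index i (all_t i)) eq_ij nth_index.
    by rewrite /nonadj eqxx /= edge_irr.
- move=> u v /sup u_s.
  have lt_u : (index u s < size t)%N by rewrite -eq_sz index_mem.
  have [k0 _] : exists k0, k0 \in t by
    case: (t) lt_u => // k0 t' _; exists k0; rewrite mem_head.
  have <- : f (nth k0 t (index u s)) = u.
    by rewrite /f index_uniq ?nth_index // ?eq_sz.
  exact: codom_f.
Qed.

Lemma nonadj_support_perm (G : sgraph) (s t : seq G) :
  perm_eq s t -> uniq t -> (forall u v, nonadj u v -> u \in t) ->
  uniq s /\ (forall u v, nonadj u v -> u \in s).
Proof.
move=> eq_st uniq_t sup; rewrite (perm_uniq eq_st); split=> // u v /sup.
by rewrite (perm_mem eq_st).
Qed.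

Section Classification.
Variables (R : rcfType) (G : sgraph).

Local Notation ord n k := (@Ordinal n k isT).
Let labels4 : seq 'I_4 := [:: ord 4 0; ord 4 1; ord 4 2; ord 4 3].

(* The cores are grouped by the multiplicity of their largest Laplacian
   eigenvalue. *)
Definition core_mult3 :=
  complement_core (complete 4) G \/ complement_core matching3 G.
Definition core_mult2 :=
  complement_core diamond G \/ complement_core (complete 3 \+g complete 2) G.
Definition core_mult1 :=
  [\/ complement_core (star 4) G, complement_core (cycle_graph 4) G,
      complement_core (path_graph 4) G
    | complement_core (kite 4 3) G \/ complement_core (star 3 \+g complete 2) G].

Let core4 (e : rel 'I_4) (a b c d : G) :
  uniq [:: a; b; c; d] ->
  (forall u v, nonadj u v -> u \in [:: a; b; c; d]) ->
  let K := mk_graph e in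
  pairwise (fun x y => nonadj x.1 y.1 == edge x.2 y.2)
    (zip [:: a; b; c; d] (labels4 : seq K)) ->
  complement_core K G.
Proof.
move=> uniq_s sup K pw.
apply: (complement_core_of_seq a (t := labels4 : seq K) _ uniq_s) => // k.
by case: k => -[|[|[|[|]]]].
Qed.

(** Here the core has a Hamiltonian path a b c d. The three other pairs of
    vertices decide which of the eight labelled graphs it is; the missing pairs determine
    the relabelling. *)
Lemma core_of_path (a b c d : G) :
  uniq [:: a; b; c; d] ->
  (forall u v, nonadj u v -> u \in [:: a; b; c; d]) ->
  nonadj a b -> nonadj b c -> nonadj c d ->
  [\/ core_mult3, core_mult2 | core_mult1].
Proof.
move=> uniq_s sup ab bc cd.
have all_s s eq_s := @nonadj_support_perm G s _ eq_s uniq_s sup.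
have ns := @nonadj_sym G.
case ac: (nonadj a c); case bd: (nonadj b d); case ad: (nonadj a d).
- apply: Or31; left.
  by apply: (core4 uniq_s) => //; rewrite /= ab ac ad bc bd cd.
- apply: Or32; left; have [|u s] := @all_s [:: a; d; b; c].
    by apply/seq.permP=> p /=; ring.
  by apply: (core4 u) => //; rewrite /= ad ab ac !(ns d) bd cd bc.
- apply: Or32; left; have [|u s] := @all_s [:: b; d; a; c].
    by apply/seq.permP=> p /=; ring.
  by apply: (core4 u) => //; rewrite /= bd (ns b a) ab bc !(ns d) ad cd ac.
- apply: Or33; apply: Or44; left.
  by apply: (core4 uniq_s) => //; rewrite /= ab ac ad bc bd cd.
- apply: Or32; left; have [|u s] := @all_s [:: a; c; b; d].
    by apply/seq.permP=> p /=; ring.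
  by apply: (core4 u) => //; rewrite /= ac ab ad (ns c b) bc cd bd.
- apply: Or33; apply: Or44; left; have [|u s] := @all_s [:: c; d; b; a].
    by apply/seq.permP=> p /=; ring.
  by apply: (core4 u) => //; rewrite /= cd (ns c) bc (ns c) ac !(ns d) bd ad (ns b) ab.
- apply: Or33; apply: Or42.
  by apply: (core4 uniq_s) => //; rewrite /= ab ac ad bc bd cd.
- apply: Or33; apply: Or43.
  by apply: (core4 uniq_s) => //; rewrite /= ab ac ad bc bd cd.
Qed.

(** With a further edge, the star with centre a contains a Hamiltonian path. *)
Lemma core_of_star (a b c d : G) :
  uniq [:: a; b; c; d] ->
  (forall u v, nonadj u v -> u \in [:: a; b; c; d]) ->
  nonadj a b -> nonadj a c -> nonadj a d ->
  [\/ core_mult3, core_mult2 | core_mult1].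
Proof.
move=> uniq_s sup ab ac ad.
have all_s s eq_s := @nonadj_support_perm G s _ eq_s uniq_s sup.
have ns := @nonadj_sym G.
case bc: (nonadj b c).
  have [|u s] := @all_s [:: b; c; a; d]; first by apply/seq.permP=> p /=; ring.
  by apply: (core_of_path u s) => //; rewrite ns.
case bd: (nonadj b d).
  have [|u s] := @all_s [:: b; d; a; c]; first by apply/seq.permP=> p /=; ring.
  by apply: (core_of_path u s) => //; rewrite ns.
case cd: (nonadj c d).
  have [|u s] := @all_s [:: c; d; a; b]; first by apply/seq.permP=> p /=; ring.
  by apply: (core_of_path u s) => //; rewrite ns.
apply: Or33; apply: Or41.
by apply: (core4 uniq_s) => //; rewrite /= ab ac ad bc bd cd.
Qed.

(* The maximal forests of the complement have three edges, in terms of the two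
   rank bounds. *)
Hypothesis growing_le3 : forall es : seq (G * G), growing es -> (size es <= 3)%N.
Hypothesis spans_ge3 : forall es : seq (G * G),
  (forall u v, nonadj u v -> spans R es u v) -> (3 <= size es)%N.

(** Fewer than three edges do not connect everything, so s misses a vertex of
    some edge of the complement. *)
Lemma nonadj_notin (s : seq G) (es : seq (G * G)) :
  (size es < 3)%N ->
  (forall u v, nonadj u v -> u \in s -> v \in s -> spans R es u v) ->
  exists u v, nonadj u v /\ v \notin s.
Proof.
move=> lt3 sp.
have [/existsP[u /existsP[v /andP[nuv vs]]]|] :=
  boolP [exists u, exists v, nonadj u v && (v \notin s)].
  by exists u, v.
rewrite negb_exists => /forallP no.
have mem u v : nonadj u v -> v \in s.
  by move=> nuv; have := no u; rewrite negb_exists => /forallP/(_ v); rewrite nuv negbK.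
have : (3 <= size es)%N; last by rewrite leqNgt lt3.
apply: spans_ge3 => u v nuv.
by apply: sp (mem _ _ nuv) => //; apply: (mem v); rewrite nonadj_sym.
Qed.

(** The complement has a path a b c. If an edge leaves these three vertices then
    it completes the path to a tree on four vertices, which is already a maximal
    forest. Otherwise the third edge of a maximal forest is disjoint from the
    path. *)
Lemma core_of_cherry (a b c : G) :
  nonadj a b -> nonadj b c -> a != c ->
  [\/ core_mult3, core_mult2 | core_mult1].
Proof.
move=> ab bc neq_ac; have ns := @nonadj_sym G.
have neq_ab := nonadj_neq ab; have neq_bc := nonadj_neq bc.
have spans_abc u v : u \in [:: a; b; c] -> v \in [:: a; b; c] ->
    spans R [:: (a, b); (b, c)] u v.
  move=> u_s v_s f ef; have fab := ef (a, b) (mem_head _ _).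
  have /= fbc : f (b, c).1 = f (b, c).2 by apply: ef; rewrite !inE eqxx orbT.
  by move: u_s v_s; rewrite !inE => /or3P[]/eqP-> /or3P[]/eqP->;
    rewrite -?fbc -?fab.
have [/existsP[x /existsP[d /and3P[xd x_s d_s]]]|no] :=
  boolP [exists x, exists d,
          [&& nonadj x d, x \in [:: a; b; c] & d \notin [:: a; b; c]]].
  have uniq_s : uniq [:: a; b; c; d].
    rewrite (perm_uniq (s2 := [:: d; a; b; c])) /=; last first.
      by apply/seq.permP=> p /=; ring.
    by rewrite d_s !inE negb_or neq_ab neq_ac neq_bc.
  have sup u v : nonadj u v -> u \in [:: a; b; c; d].
    move=> nuv; apply: contraT => u_s.
    suff /growing_le3 : growing [:: (v, u); (x, d); (b, c); (a, b)] by [].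
    rewrite /= ns nuv xd bc ab /=.
    move: u_s d_s; rewrite !inE !negb_or => /and4P[ua ub uc ud] /and3P[da db dc].
    rewrite ua ub uc ud da db dc !(eq_sym c) neq_ac neq_bc !andbT /=.
    by move: x_s; rewrite !inE => /or3P[]/eqP->.
  have all_s s eq_s := @nonadj_support_perm G s _ eq_s uniq_s sup.
  move: x_s xd; rewrite !inE => /or3P[]/eqP-> xd.
  - have [|u s] := @all_s [:: d; a; b; c]; first by apply/seq.permP=> p /=; ring.
    by apply: (core_of_path u s) => //; rewrite ns.
  - have [|u s] := @all_s [:: b; a; c; d]; first by apply/seq.permP=> p /=; ring.
    by apply: (core_of_star u s) => //; rewrite ns.
  - exact: core_of_path sup ab bc xd.
have {}no u v : u \in [:: a; b; c] -> v \notin [:: a; b; c] -> nonadj u v = false.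
  move=> u_s v_s; apply: contraNF no => nuv.
  by apply/existsP; exists u; apply/existsP; exists v; apply/and3P.
have [//||x [d [xd d_s]]] := @nonadj_notin [:: a; b; c] [:: (a, b); (b, c)].
  by move=> u v _; apply: spans_abc.
have x_s : x \notin [:: a; b; c] by apply: contraTN xd => /no ->.
have neq_xd := nonadj_neq xd.
have uniq_s : uniq [:: b; a; c; x; d].
  move: x_s d_s; rewrite /= !inE !negb_or => /and3P[xa xb xc] /and3P[da db dc].
  rewrite neq_xd neq_ac neq_bc !(eq_sym _ x) !(eq_sym _ d) xa xb xc da db dc.
  by rewrite eq_sym neq_ab.
have sup u v : nonadj u v -> u \in [:: b; a; c; x; d].
  move=> nuv; apply: contraT => u_s.
  suff /growing_le3 : growing [:: (v, u); (x, d); (b, c); (a, b)] by [].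
  rewrite /= ns nuv xd bc ab /=.
  move: u_s d_s; rewrite !inE !negb_or.
  move=> /and5P[ub ua uc ux ud] /and3P[da db dc].
  by rewrite ua ub uc ux ud da db dc !(eq_sym c) neq_ac neq_bc.
pose t : seq ('I_3 + 'I_2) :=
  [:: inl (ord 3 0); inl (ord 3 1); inl (ord 3 2); inr (ord 2 0); inr (ord 2 1)].
have all_t k : k \in t by case: k => -[[|[|[|]]]].
have no_ax := no a x (mem_head _ _) x_s; have no_ad := no a d (mem_head _ _) d_s.
have [no_bx no_bd] : nonadj b x = false /\ nonadj b d = false.
  by split; apply: no => //; rewrite !inE eqxx orbT.
have [no_cx no_cd] : nonadj c x = false /\ nonadj c d = false.
  by split; apply: no => //; rewrite !inE eqxx !orbT.
case ac: (nonadj a c).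
  apply: Or32; right.
  apply: (@complement_core_of_seq (complete 3 \+g complete 2) _ a _ t _ uniq_s) => //.
  by rewrite /= (ns b a) ab bc no_bx no_bd ac no_ax no_ad no_cx no_cd xd.
apply: Or33; apply: Or44; right.
apply: (@complement_core_of_seq (star 3 \+g complete 2) _ a _ t _ uniq_s) => //.
by rewrite /= (ns b a) ab bc no_bx no_bd ac no_ax no_ad no_cx no_cd xd.
Qed.

(** No two edges of the complement meet, so every vertex has at most one
    partner, and three edges are found greedily. A set that is a union of edges
    cannot be left by an edge. *)
Lemma core_of_matching :
  (forall a b c : G, nonadj a b -> nonadj b c -> a = c) ->
  complement_core matching3 G.
Proof.
move=> mt; have ns := @nonadj_sym G.
have partner (x y : G) : nonadj x y -> forall z, nonadj x z = (y == z).
  move=> xy z; apply/idP/eqP => [xz|<- //].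
  by apply: mt xz; rewrite ns.
pose closed (s : seq G) := forall u v : G, nonadj u v -> v \notin s -> u \notin s.
have closed_cons s (x y : G) : closed s -> nonadj x y -> closed [:: x, y & s].
  move=> cl xy u v uv; rewrite !inE !negb_or => /and3P[vx vy /(cl _ _ uv) ->].
  rewrite andbT; apply/andP; split.
    by apply: contraNneq vy => ux; rewrite eq_sym -(partner _ _ xy) -ux.
  by apply: contraNneq vx => uy; rewrite eq_sym -(partner y) -?uy // ns uy.
have [//|//|a [b [ab _]]] := @nonadj_notin [::] [::].
have cl_ab : closed [:: a; b] by apply: closed_cons.
have [//||c [d [cd d_s]]] := @nonadj_notin [:: a; b] [:: (a, b)].
  move=> u v _ u_s v_s x /(_ (a, b) (mem_head _ _)) /= xab.
  by move: u_s v_s; rewrite !inE => /orP[]/eqP-> /orP[]/eqP->.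
have cl_cdab : closed [:: c; d; a; b] by apply: closed_cons.
have [//||e [f [ef f_s]]] := @nonadj_notin [:: c; d; a; b] [:: (a, b); (c, d)].
  move=> u v uv u_s _ x x_es; have /= xab := x_es (a, b) (mem_head _ _).
  have /= xcd : x (c, d).1 = x (c, d).2 by apply: x_es; rewrite !inE eqxx orbT.
  move: u_s uv; rewrite !inE => /or4P[]/eqP->.
  - by rewrite (partner _ _ cd) => /eqP <-.
  - by rewrite (partner _ c) 1?ns // => /eqP <-.
  - by rewrite (partner _ _ ab) => /eqP <-.
  - by rewrite (partner _ a) 1?ns // => /eqP <-.
have cl_s : closed [:: e; f; c; d; a; b] by apply: closed_cons.
have uniq_cons2 s (x y : G) :
    nonadj x y -> y \notin s -> x \notin s -> uniq s -> uniq [:: x, y & s].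
  by move=> /nonadj_neq neq_xy ys xs us; rewrite /= inE negb_or neq_xy xs ys.
have uniq_s : uniq [:: e; f; c; d; a; b].
  apply: (uniq_cons2 _ _ _ ef f_s (cl_cdab _ _ ef f_s)).
  apply: (uniq_cons2 _ _ _ cd d_s (cl_ab _ _ cd d_s)).
  exact: (uniq_cons2 _ _ _ ab).
have sup u v : nonadj u v -> u \in [:: e; f; c; d; a; b].
  move=> uv; apply: contraT => u_s; have v_s : v \notin [:: e; f; c; d; a; b].
    by apply: cl_s u_s; rewrite ns.
  suff /growing_le3 : growing [:: (v, u); (e, f); (c, d); (a, b)] by [].
  rewrite /= ns uv ef cd ab /=; move: u_s f_s d_s; rewrite !inE !negb_or.
  by case/and5P=> -> -> -> -> /andP[-> ->] /and4P[-> -> -> ->] /andP[-> ->].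
pose t : seq ('I_2 + 'I_2 + 'I_2) :=
  [:: inl (inl (ord 2 0)); inl (inl (ord 2 1)); inl (inr (ord 2 0));
      inl (inr (ord 2 1)); inr (ord 2 0); inr (ord 2 1)].
have all_t k : k \in t by case: k => [[]|] [[|[|]]].
apply: (@complement_core_of_seq matching3 _ a _ t _ uniq_s) => //.
have fe : nonadj f e by rewrite ns.
have dc : nonadj d c by rewrite ns.
rewrite /= !(partner _ _ ef) !(partner _ _ fe) !(partner _ _ cd).
rewrite !(partner _ _ dc) !(partner _ _ ab) !eqxx.
move: uniq_s; rewrite /= !inE !negb_or -!andbA.
case/and5P=> _ ec ed ea /and5P[eb fc fd fa] /and5P[fb _ ca cb /and4P[da db _ _]].
by rewrite !(negPf ec, negPf ed, negPf ea, negPf eb, negPf fc, negPf fd, negPf fa,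
             negPf fb, negPf ca, negPf cb, negPf da, negPf db).
Qed.

Lemma core_classification : [\/ core_mult3, core_mult2 | core_mult1].
Proof.
have [/existsP[a /existsP[b /existsP[c /and3P[ab bc ac]]]]|no] :=
  boolP [exists a, exists b, exists c, [&& nonadj a b, nonadj b c & a != c :> G]].
  exact: core_of_cherry ab bc ac.
apply: Or31; right; apply: core_of_matching => a b c ab bc.
apply: contraNeq no => ac.
apply/existsP; exists a; apply/existsP; exists b; apply/existsP; exists c.
exact/and3P.
Qed.
End Classification.

(** * The spectrum of a graph with a small complement core *)

(** The columns of P are eigenvectors of A, pairwise orthogonal when the entries
    of c are nonzero, and they account for all the eigenvalues other than a. *)
Lemma char_poly_orthogonal (R : rcfType) (n r : nat) (A : 'M[R]_n) (a : R)
    (P : 'M[R]_(n, r)) (c mu : 'rV[R]_r) :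
  (r <= n)%N -> A - a%:M = P *m diag_mx c *m P^T ->
  diag_mx c *m P^T *m P = diag_mx mu ->
  char_poly A = ('X - a%:P) ^+ (n - r) * \prod_l ('X - (a + mu 0 l)%:P).
Proof.
move=> le_rn; rewrite -mulmxA => /char_poly_sylvester defA defmu.
apply: (@mulIf _ (('X - a%:P) ^+ r)); first by rewrite expf_neq0 ?polyXsubC_eq0.
rewrite defA defmu mulrAC -exprD subnK //; congr (_ * _).
rewrite map_diag_mx -diag_const_mx -raddfB /= det_diag; apply: eq_bigr => l _.
by rewrite !mxE polyCD opprD addrA.
Qed.

Section Core.
Variables (R : rcfType) (K G : sgraph) (f : K -> G).
Hypothesis inj_f : injective f.
Hypothesis nonadj_f : forall i j, nonadj (f i) (f j) = edge i j.
Hypothesis sup_f : forall u v : G, nonadj u v -> u \in codom f.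
Local Notation n := #|G|.

Hypothesis common_non_neighbor : (#|K| < n)%N \/
  forall i j : K, edge i j ->
    exists w : K, [/\ i != w, w != j, ~~ edge i w & ~~ edge w j].

(** The complement of G is disconnected: it has an isolated vertex w, or its core
    has a vertex w adjacent to neither u nor v. *)
Lemma common_neighbor (u v : G) :
  nonadj u v -> exists w : G, edge u w && edge w v.
Proof.
move=> nuv; have [j def_v] : exists j, v = f j.
  by apply/codomP; rewrite (sup_f (v := u)) // nonadj_sym.
have /codomP[i def_u] := sup_f nuv; rewrite {}def_u {}def_v in nuv *.
case: common_non_neighbor => [lt_n|/(_ i j)]; last first.
  rewrite -nonadj_f => /(_ nuv)[w [iw wj niw nwj]]; exists (f w).
  by rewrite !edge_nonadj ?(inj_eq inj_f) // !nonadj_f niw nwj.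
have [w w_f] : exists w, w \notin codom f.
  apply/existsP; apply: contraLR lt_n; rewrite negb_exists => /forallP w_f.
  rewrite -leqNgt -(card_codom inj_f); apply/subset_leq_card/subsetP => w _.
  by have := w_f w; rewrite negbK.
have sep k : f k != w by apply: contraNneq w_f => <-; apply: codom_f.
have no x : nonadj w x = false by apply: contraNF w_f => /sup_f.
by exists w; rewrite !edge_nonadj ?sep // 1?eq_sym ?sep // nonadj_sym !no.
Qed.

Lemma dist_core (u v : G) : u != v -> dist u v = (1 + nonadj u v)%N.
Proof.
move=> neq_uv; have [nuv|uv] := boolP (nonadj u v).
  have [w /andP[uw wv]] := common_neighbor nuv.
  exact: dist_common_neighbor nuv uw wv.
by rewrite dist_edge // edge_nonadj.
Qed.

(* The Laplacian of K is the sum of the c_l p_l p_l^T, with the p_l pairwise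
   orthogonal and orthogonal to the constants; only its off-diagonal entries have
   to be checked, because its rows sum to zero. *)
Variables (p : 'I_3 -> K -> R) (c mu : 'I_3 -> R).
Hypothesis sum_p : forall l, \sum_i p l i = 0.
Hypothesis orth_p : forall l m,
  c l * (\sum_i p l i * p m i) = mu l *+ (l == m).
Hypothesis laplacian_p : forall i j, i != j ->
  \sum_l c l * p l i * p l j = - (edge i j)%:R.

(* The vector p l extended by zero outside of the core. *)
Let pext l u := \sum_k p l k *+ (f k == u).

Let pext_f l k : pext l (f k) = p l k.
Proof.
rewrite /pext (bigD1 k) //= eqxx mulr1n big1 ?addr0 // => j /negPf.
by rewrite (inj_eq inj_f) => ->.
Qed.

Let pext_out l u : u \notin codom f -> pext l u = 0.
Proof.
by move=> uf; rewrite /pext big1 // => k _; case: eqP uf => // <-; rewrite codom_f.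
Qed.

Let sum_pext l (h : G -> R) : \sum_u pext l u * h u = \sum_k p l k * h (f k).
Proof.
under eq_bigr do rewrite mulr_suml.
rewrite exchange_big; apply: eq_bigr => k _ /=.
rewrite (bigD1 (f k)) //= eqxx big1 ?addr0 // => u /negPf.
by rewrite eq_sym => ->; rewrite mul0r.
Qed.

(* The constant vector, of squared norm n, comes with the coefficient - 1 and the
   eigenvalue - n: this is the term - J. *)
Let q (l : 'I_4) u := if unlift ord0 l is Some l' then pext l' u else 1.
Let qc (l : 'I_4) := if unlift ord0 l is Some l' then c l' else - 1.
Let qmu (l : 'I_4) := if unlift ord0 l is Some l' then mu l' else - n%:R.

Lemma shifted_laplacian_core :
  let P := \matrix_(i, l) q l (enum_val i) in
  shifted_laplacian R G = P *m diag_mx (\row_l qc l) *m P^T.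
Proof.
move=> P.
have entry i j : (P *m diag_mx (\row_l qc l) *m P^T) i j =
    - 1 + \sum_l c l * pext l (enum_val i) * pext l (enum_val j).
  rewrite mxE big_ord_recl mul_mx_diag !mxE /q /qc !unlift_none mul1r mulr1.
  congr (_ + _); apply: eq_bigr => l _; rewrite !mxE /q /qc !liftK.
  by rewrite [c l * _]mulrC.
have off i j : i != j -> shifted_laplacian R G i j =
    (P *m diag_mx (\row_l qc l) *m P^T) i j.
  move=> neq_ij; rewrite entry !mxE (negPf neq_ij) !mulr0n !subr0 sub0r.
  have : enum_val i != enum_val j by rewrite (inj_eq enum_val_inj).
  move: (enum_val i) (enum_val j) => u v neq_uv; rewrite dist_core //.
  rewrite natrD opprD; congr (_ + _).
  have [/codomP[k def_u]|uf] := boolP (u \in codom f); last first.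
    case nuv: (nonadj u v); first by rewrite (sup_f nuv) in uf.
    rewrite mulr0n oppr0 big1 // => l _.
    by rewrite (pext_out _ uf) mulr0 mul0r.
  have [/codomP[k' def_v]|vf] := boolP (v \in codom f); last first.
    case nuv: (nonadj u v).
      by rewrite nonadj_sym in nuv; rewrite (sup_f nuv) in vf.
    rewrite mulr0n oppr0 big1 // => l _.
    by rewrite (pext_out _ vf) mulr0.
  rewrite {1}def_u {1}def_v nonadj_f -laplacian_p; last first.
    by apply: contraNneq neq_uv => eq_k; rewrite def_u def_v eq_k.
  by apply: eq_bigr => l _; rewrite def_u def_v !pext_f.
(* The diagonal is determined by the row sums, all equal to - n. *)
apply/matrixP=> i j; have [<-{j}|/off //] := eqVneq i j.
have rowsA : \sum_j shifted_laplacian R G i j = - n%:R.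
  have := mul_shifted_laplacian (const_mx 1 : 'cV[R]_n) i 0.
  rewrite mxE; under eq_bigr do rewrite [const_mx _ _ _]mxE mulr1.
  move=> ->.
  rewrite big1 ?sub0r => [|j _]; last by rewrite !mxE subrr mulr0.
  by congr (- _); under eq_bigr do rewrite mxE; rewrite sumr_const card_ord.
have rowsP : \sum_j (P *m diag_mx (\row_l qc l) *m P^T) i j = - n%:R.
  under eq_bigr do rewrite entry.
  rewrite big_split /= sumr_const card_ord exchange_big /= big1 ?addr0.
    by rewrite mulNrn.
  move=> l _; rewrite -mulr_sumr.
  rewrite -(sum_enum_val (fun u => pext l u)).
  rewrite -[X in _ * X](eq_bigr _ (fun u _ => mulr1 (pext l u))) sum_pext.
  by under eq_bigr do rewrite mulr1; rewrite sum_p mulr0.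
apply: (addIr (\sum_(j | j != i) shifted_laplacian R G i j)).
transitivity (- n%:R : R); first by rewrite -rowsA [RHS](bigD1 i).
rewrite -rowsP (bigD1 i) //=; congr (_ + _).
by apply: eq_bigr => j neq_ji; rewrite off // eq_sym.
Qed.

Lemma char_poly_core : (4 <= n)%N ->
  char_poly (dist_laplacian R G) =
  ('X - n%:R%:P) ^+ (n - 4)
    * ('X * \prod_l ('X - (n%:R + mu l)%:P)).
Proof.
move=> n_ge4.
rewrite (char_poly_orthogonal (mu := \row_l qmu l) n_ge4 shifted_laplacian_core).
  rewrite big_ord_recl !mxE /qmu unlift_none subrr subr0.
  congr (_ * (_ * _)); apply: eq_bigr => l _.
  by rewrite mxE liftK.
rewrite -mulmxA; apply/matrixP=> l m; rewrite mul_diag_mx !mxE.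
under eq_bigr do rewrite !mxE.
rewrite -(sum_enum_val (fun u => q l u * q m u)) /q /qc /qmu.
case: (unliftP ord0 l) => [l'|] ->; case: (unliftP ord0 m) => [m'|] ->.
- rewrite sum_pext (inj_eq lift_inj) -orth_p.
  by under eq_bigr do rewrite pext_f.
- by rewrite sum_pext; under eq_bigr do rewrite mulr1; rewrite sum_p mulr0.
- under eq_bigr do rewrite mulrC; rewrite sum_pext.
  by under eq_bigr do rewrite mulr1; rewrite sum_p mulr0.
- by under eq_bigr do rewrite mulr1; rewrite sumr_const mulN1r eqxx mulr1n.
Qed.

(** The spectrum is n + a, n + b, n + d, then n repeated n - 4 times, then 0. *)
Lemma dL_core (a b d : R) : (5 <= n)%N ->
  (forall l : 'I_3, mu l = [:: a; b; d]`_l) -> a >= b -> b >= d -> d > 0 ->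
  [/\ dL_mult R G 1 = (1 + (b == a) + (d == a))%N, dL_eig R G n.-1 = n%:R
    & dL_mult R G n.-1 = (n - 4)%N].
Proof.
move=> n_ge5 muE le_ba le_db d_gt0.
pose s : seq R :=
  [:: n%:R + a; n%:R + b; n%:R + d] ++ nseq (n - 4) n%:R ++ [:: 0].
have polyE : char_poly (dist_laplacian R G) = \prod_(z <- s) ('X - z%:P).
  rewrite char_poly_core ?(ltnW n_ge5) // !big_cat /= big_nseq iter_mulr_1.
  rewrite !big_cons big_nil !big_ord_recl big_ord0 !muE /= subr0 !mulr1.
  by rewrite mulrA mulrC.
have specE : spectrum (dist_laplacian R G) = s.
  apply: spectrum_prod_XsubC polyE _; rewrite /= !lerD2l le_ba le_db /=.
  have: n%:R + d >= n%:R :> R by rewrite lerDl ltW.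
  elim: (n - 4)%N (n%:R + d) => [|m IH] x le_x /=.
    by rewrite andbT (le_trans _ le_x) ?ler0n.
  by rewrite le_x IH.
have b_gt0 := lt_le_trans d_gt0 le_db; have a_gt0 := lt_le_trans b_gt0 le_ba.
have eig_n : dL_eig R G n.-1 = n%:R.
  rewrite /dL_eig specE /s; case: (#|G|) n_ge5 => [|[|[|[|[|m]]]]] // _.
  rewrite /= -[nth _ _ _]/(nth 0 (nseq m.+1 m.+4.+1%:R ++ [:: 0]) m).
  by rewrite nth_cat size_nseq leqnn nth_nseq leqnn.
have neq_n x : x > 0 -> (n%:R + x == n%:R :> R) = false.
  by move=> x_gt0; rewrite -subr_eq0 addrC addKr gt_eqF.
have neq_0 : ((0 : R) == n%:R) = false.
  by rewrite eq_sym pnatr_eq0 gtn_eqF // (leq_trans _ n_ge5).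
have neq_a0 : ((0 : R) == n%:R + a) = false.
  by rewrite lt_eqF // ltr_wpDl ?ler0n.
split=> //; rewrite /dL_mult ?eig_n /dL_eig ?specE /eig_mult polyE mu_prod_XsubC;
    rewrite /= count_cat count_nseq /= ?addn0.
  rewrite eqxx !(inj_eq (addrI _)) [n%:R == _]eq_sym neq_n // neq_a0 mul0n !addn0.
  by rewrite addnA.
by rewrite !neq_n // neq_0 eqxx mul1n addn0.
Qed.
End Core.

(** * Recognising the graphs of the theorem by their complement core *)

Lemma nonadj_complement (H : sgraph) (u v : H) :
  @nonadj (complement H) u v = edge u v.
Proof.
rewrite /nonadj /= /mk_rel /= negb_and negbK -negb_and negbK (edge_sym v) andbb.
by case: eqVneq => //= ->; rewrite edge_irr.
Qed.

Lemma edge_inl (G H : sgraph) (u v : G) :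
  @edge (G \+g H) (inl u) (inl v) = edge u v.
Proof.
rewrite /= /mk_rel /= (edge_sym v) orbb (inj_eq inl_inj).
by case: eqVneq => //= ->; rewrite edge_irr.
Qed.

Lemma edge_inr (G H : sgraph) (u v : H) :
  @edge (G \+g H) (inr u) (inr v) = edge u v.
Proof.
rewrite /= /mk_rel /= (edge_sym v) orbb (inj_eq inr_inj).
by case: eqVneq => //= ->; rewrite edge_irr.
Qed.

Lemma edge_inl_inr (G H : sgraph) (u : G) (v : H) :
  @edge (G \+g H) (inl u) (inr v) = false.
Proof. by []. Qed.

Lemma edge_inr_inl (G H : sgraph) (u : H) (v : G) :
  @edge (G \+g H) (inr u) (inl v) = false.
Proof. by []. Qed.

Lemma edge_edgeless (m : nat) (i j : edgeless m) : edge i j = false.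
Proof. by rewrite /= /mk_rel /= andbF. Qed.

Definition edge_unionE :=
  (edge_inl, edge_inr, edge_inl_inr, edge_inr_inl, edge_edgeless).

Lemma edge_complete (m : nat) (i j : complete m) : edge i j = (i != j).
Proof. by rewrite /= /mk_rel /= andbT. Qed.

Lemma complement_core_isolated (K : sgraph) (m : nat) :
  complement_core K (complement (K \+g edgeless m)).
Proof.
exists inl; split=> [i j []|i j|u v] //.
  by rewrite nonadj_complement edge_inl.
rewrite nonadj_complement; case: u => [u|u]; first by rewrite codom_f.
by case: v => v; rewrite !edge_unionE.
Qed.

Lemma complement_core_iso (K G H : sgraph) :
  G ~=g H -> complement_core K H -> complement_core K G.
Proof.
case=> f [[g fK gK] f_edge] [h [inj_h nonadj_h sup_h]].
have nonadj_fE u v : nonadj (f u) (f v) = nonadj u v.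
  by rewrite /nonadj (inj_eq (can_inj fK)) f_edge.
exists (g \o h); split=> [|i j|u v /=].
- exact: inj_comp (can_inj gK) inj_h.
- by rewrite -nonadj_fE /= !gK.
- rewrite -nonadj_fE => /sup_h/codomP[k def_fu]; apply/codomP; exists k.
  by rewrite /= -def_fu fK.
Qed.

(** Match the cores, then the remaining vertices in any order: the latter are
    isolated in both complements. *)
Lemma complement_core_unique (K G H : sgraph) :
  #|G| = #|H| -> complement_core K G -> complement_core K H -> G ~=g H.
Proof.
move=> eqGH [f [inj_f nonadj_f sup_f]] [g [inj_g nonadj_g sup_g]].
(* Enumerate both graphs with the cores first, in the order of K. *)
pose s : seq G := codom f ++ enum [predC codom f].
pose t : seq H := codom g ++ enum [predC codom g].
have uniq_cat (L : sgraph) (h : K -> L) : injective h ->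
    uniq (codom h ++ enum [predC codom h]).
  move=> inj_h; rewrite cat_uniq enum_uniq andbT; apply/andP; split.
    exact/injectiveP.
  by apply/hasPn=> x; rewrite mem_enum.
have uniq_s : uniq s := uniq_cat _ _ inj_f.
have uniq_t : uniq t := uniq_cat _ _ inj_g.
have mem_s x : x \in s by rewrite mem_cat mem_enum inE /= orbN.
have sz_st : size s = size t.
  have sz (L : sgraph) (h : K -> L) : injective h ->
      size (codom h ++ enum [predC codom h]) = #|L|.
    move=> inj_h; rewrite -(cardC (mem (codom h))) size_cat -cardE.
    by rewrite size_codom -(card_codom inj_h).
  by rewrite !sz.
have h_lt x : (index x s < size t)%N by rewrite -sz_st index_mem.
pose h x := tnth (in_tuple t) (Ordinal (h_lt x)).
have hE y0 x : h x = nth y0 t (index x s) by rewrite /h (tnth_nth y0).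
have inj_h : injective h.
  move=> x y; have y0 := h x; rewrite !(hE y0) => /eqP.
  rewrite nth_uniq // => /eqP eq_xy.
  by rewrite -[x](nth_index x (mem_s x)) eq_xy nth_index.
have hf k : h (f k) = g k.
  have k_in : (index k (enum K) < size (enum K))%N by rewrite index_mem mem_enum.
  rewrite (hE (g k)) /s /t index_cat nth_cat codom_f !codomE index_map //.
  by rewrite size_map k_in (nth_map k) // nth_index ?mem_enum.
exists h; split; first by apply: inj_card_bij => //; rewrite eqGH.
have out x : x \notin codom f -> h x \notin codom g.
  by apply: contraNN => /codomP[k]; rewrite -hf => /inj_h ->; apply: codom_f.
move=> u v; have [->|neq_uv] := eqVneq u v; first by rewrite !edge_irr.
rewrite !edge_nonadj ?(inj_eq inj_h) //; congr (~~ _).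
have no_out (L : sgraph) (e : K -> L) x y :
    (forall x y : L, nonadj x y -> x \in codom e) ->
    x \notin codom e -> nonadj x y = false /\ nonadj y x = false.
  by move=> sup xe; rewrite [nonadj y x]nonadj_sym; split; apply: contraNF xe => /sup.
have [/codomP[i ->]|uf] := boolP (u \in codom f); last first.
  by rewrite (no_out _ f u v sup_f uf).1 (no_out _ g _ _ sup_g (out u uf)).1.
have [/codomP[j ->]|vf] := boolP (v \in codom f); last first.
  by rewrite (no_out _ f v _ sup_f vf).2 (no_out _ g _ _ sup_g (out v vf)).2.
by rewrite !hf nonadj_f nonadj_g.
Qed.

Lemma card_complement_isolated (K : sgraph) (m : nat) :
  #|complement (K \+g edgeless m)| = (#|K| + m)%N.
Proof. by rewrite card_sum card_ord. Qed.

Lemma iso_complement_isolated (K G : sgraph) (m : nat) : #|G| = (#|K| + m)%N ->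
  G ~=g complement (K \+g edgeless m) <-> complement_core K G.
Proof.
move=> cardG; split=> [isoG | coreG].
  exact: complement_core_iso isoG (complement_core_isolated K m).
apply: complement_core_unique coreG (complement_core_isolated K m).
by rewrite card_complement_isolated.
Qed.

(** * The cores of complete multipartite graphs and of SK + e *)

Section Multipartite.
Variable ts : seq nat.
Local Notation V := (complete_multipartite ts).

Lemma nonadj_multipartite (u v : V) :
  nonadj u v = (u != v) && (tag u == tag v).
Proof.
rewrite /nonadj /= /mk_rel /= (eq_sym (tag v)) orbb.
by case: (u =P v) => //= _; rewrite negbK.
Qed.

Lemma multipartite_eq (u v : V) :
  tag u = tag v :> nat -> tagged u = tagged v :> nat -> u = v.
Proof.
by case: u v => i x [j y] /= /val_inj eq_ij; subst j => /val_inj ->.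
Qed.

Lemma card_multipartite : #|V| = sumn ts.
Proof.
rewrite card_tagged; congr sumn.
rewrite (eq_map (fun i : 'I_(size ts) => card_ord (nth 0%N ts i))).
by rewrite (map_comp (nth 0%N ts) val) val_enum_ord map_nth_iota0 ?take_size.
Qed.

(** The complement is a union of cliques, one for each class, and the classes of
    size one are its isolated vertices. *)
Lemma complement_core_multipartite (K : sgraph) (h : K -> V) :
  injective h -> (forall i j, edge i j = (i != j) && (tag (h i) == tag (h j))) ->
  (forall u : V, (1 < nth 0 ts (tag u))%N -> u \in codom h) ->
  complement_core K V.
Proof.
move=> inj_h edge_h sup_h; exists h; split=> // [i j|u v].
  by rewrite nonadj_multipartite (inj_eq inj_h) edge_h.
rewrite nonadj_multipartite => /andP[neq_uv /eqP eq_tag]; apply: sup_h.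
case: u v eq_tag neq_uv => i x [j y] /= eq_ij; subst j => neq_xy.
rewrite ltnNge; apply: contra neq_xy => le1.
apply/eqP/multipartite_eq => //=; have := ltn_ord x; have := ltn_ord y; lia.
Qed.
End Multipartite.

Lemma core_K4 (m : nat) :
  complement_core (complete 4) (complete_multipartite (4%N :: nseq m 1%N)).
Proof.
set ts := 4%N :: _.
pose h (i : complete 4) : complete_multipartite ts :=
  @existT 'I_(size ts) (fun i => 'I_(nth 0%N ts i)) ord0 i.
apply: (complement_core_multipartite (h := h)) => [i j /eqP|i j|].
- by rewrite /h eq_Tagged => /eqP.
- by rewrite eqxx.
- case=> [[[|k] lt_k] x] /=; last by rewrite nth_nseq; case: ifP.
  by move=> _; apply/codomP; exists x; apply: (@multipartite_eq ts).
Qed.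

Lemma core_matching3 (m : nat) :
  complement_core matching3 (complete_multipartite ([:: 2; 2; 2]%N ++ nseq m 1%N)).
Proof.
set ts := _ ++ _.
pose T (i : 'I_(size ts)) := 'I_(nth 0%N ts i).
pose h (x : matching3) : complete_multipartite ts :=
  match x with
  | inl (inl i) => @existT _ T (@Ordinal (size ts) 0 isT) i
  | inl (inr i) => @existT _ T (@Ordinal (size ts) 1 isT) i
  | inr i => @existT _ T (@Ordinal (size ts) 2 isT) i
  end.
apply: (complement_core_multipartite (h := h)) => [i j eq_h|i j|].
- have := congr1 (fun u : complete_multipartite ts =>
                    (val (tag u), val (tagged u))) eq_h.
  by case: i j {eq_h} => [[]|] i [[]|] j //= [] /val_inj ->.
- case: i j => [[]|] i [[]|] j; rewrite ?(edge_unionE, edge_complete) //.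
  + by rewrite eqxx andbT !(inj_eq inl_inj).
  + by rewrite eqxx andbT (inj_eq inl_inj) (inj_eq inr_inj).
  + by rewrite eqxx andbT (inj_eq inr_inj).
- case=> [[[|[|[|k]]] lt_k] x] //=; last by rewrite nth_nseq; case: ifP.
  + by move=> _; apply/codomP; exists (inl (inl x)); apply: (@multipartite_eq ts).
  + by move=> _; apply/codomP; exists (inl (inr x)); apply: (@multipartite_eq ts).
  + by move=> _; apply/codomP; exists (inr x); apply: (@multipartite_eq ts).
Qed.

Lemma core_K3_K2 (m : nat) :
  complement_core (complete 3 \+g complete 2)
    (complete_multipartite ([:: 3; 2]%N ++ nseq m 1%N)).
Proof.
set ts := _ ++ _.
pose T (i : 'I_(size ts)) := 'I_(nth 0%N ts i).
pose h (x : complete 3 \+g complete 2) : complete_multipartite ts :=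
  match x with
  | inl i => @existT _ T (@Ordinal (size ts) 0 isT) i
  | inr i => @existT _ T (@Ordinal (size ts) 1 isT) i
  end.
apply: (complement_core_multipartite (h := h)) => [i j eq_h|i j|].
- have := congr1 (fun u : complete_multipartite ts =>
                    (val (tag u), val (tagged u))) eq_h.
  by case: i j {eq_h} => i [] j //= [] /val_inj ->.
- case: i j => i [] j; rewrite ?(edge_unionE, edge_complete) //.
  + by rewrite eqxx andbT (inj_eq inl_inj).
  + by rewrite eqxx andbT (inj_eq inr_inj).
- case=> [[[|[|k]] lt_k] x] //=; last by rewrite nth_nseq; case: ifP.
  + by move=> _; apply/codomP; exists (inl x); apply: (@multipartite_eq ts).
  + by move=> _; apply/codomP; exists (inr x); apply: (@multipartite_eq ts).
Qed.

(** Two non-adjacent vertices of the split graph both lie in its independent set of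
    size four, and a permutation of this set carries 0 and 1 to them. *)
Lemma core_add_edge (m : nat) (a b : complement (complete 4 \+g edgeless m)) :
  a != b -> ~~ edge a b -> complement_core diamond (add_edge a b).
Proof.
set S := complement _ => neq_ab nab.
have nonadj_S (x y : S) : nonadj x y = edge (x : complete 4 \+g edgeless m) y.
  exact: nonadj_complement.
have [a' [b' [def_a def_b]]] : exists a' b' : 'I_4, a = inl a' /\ b = inl b'.
  have : nonadj a b by apply/andP.
  rewrite nonadj_S; case: (a) (b) => x [] y; rewrite !edge_unionE // => _.
  by exists x, y.
have neq_ab' : a' != b' by apply: contraNneq neq_ab => e; rewrite def_a def_b e.
pose o0 : 'I_4 := @Ordinal 4 0 isT; pose o1 : 'I_4 := @Ordinal 4 1 isT.
pose s1 := tperm o1 (tperm o0 a' b').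
pose s i := tperm o0 a' (s1 i).
have s0 : s o0 = a'.
  rewrite /s /s1 (tpermD (z := o0)) ?tpermL //.
  by apply: contraNneq neq_ab' => e; rewrite -[b'](tpermK o0 a') e tpermL.
have s1b : s o1 = b' by rewrite /s /s1 tpermL tpermK.
have inj_s : injective s by apply: inj_comp; apply: perm_inj.
have nonadj_add (x y : S) : @nonadj (add_edge a b) x y =
    nonadj x y && ~~ ((x == a) && (y == b) || (y == a) && (x == b)).
  rewrite /nonadj; have -> : @edge (add_edge a b) x y =
    (x != y) && ((edge x y || (x == a) && (y == b))
                 || (edge y x || (y == a) && (x == b))) by [].
  by rewrite (edge_sym y); case: (x =P y) => // _; case: (edge x y).
exists (fun i => inl (s i)); split=> [i j [/inj_s]|i j|u v] //.
  rewrite nonadj_add nonadj_S edge_inl edge_complete (inj_eq inj_s).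
  rewrite def_a def_b -s0 -s1b !(inj_eq inl_inj) !(inj_eq inj_s).
  by case: i j => [[|[|[|[|]]]] ?] // [[|[|[|[|]]]] ?].
rewrite nonadj_add nonadj_S => /andP[uv _]; case: u uv => [x|x] uv.
  by apply/codomP; exists (s1 (tperm o0 a' x)); rewrite /s /s1 !tpermK.
by case: v uv => v; rewrite !edge_unionE.
Qed.

(** * The nine spectra *)

Section Spectra.
Variables (R : rcfType) (G : sgraph).
Local Notation n := #|G|.
Hypothesis n_ge5 : (5 <= n)%N.

(** The common form of the three conditions of the theorem. *)
Definition dL_top_mult (m : nat) :=
  [/\ dL_mult R G 1 = m, dL_eig R G n.-1 = n%:R & dL_mult R G n.-1 = (n - 4)%N].

Lemma common_non_neighbor_union (K L : sgraph) (x : K) (y : L) (i j : K \+g L) :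
  edge i j -> exists w : K \+g L, [/\ i != w, w != j, ~~ edge i w & ~~ edge w j].
Proof.
by case: i j => i [] j ij; [exists (inr y) | | | exists (inl x)].
Qed.

(** Once the vectors and coefficients of an explicit core are given, the goals
    left are finitely many linear identities over the rationals, or with sqrt 2. *)
Lemma dL_complement_core (K : sgraph) (p : seq (K -> R)) (c mu : seq R) (m : nat) :
  let P := nth (fun=> 0) p in
  complement_core K G ->
  ((#|K| < n)%N \/ forall i j : K, edge i j ->
     exists w : K, [/\ i != w, w != j, ~~ edge i w & ~~ edge w j]) ->
  (forall l : 'I_3, \sum_i P l i = 0) ->
  (forall l m : 'I_3,
     c`_l * (\sum_i P l i * P m i) = if l == m :> nat then mu`_l else 0) ->
  (forall i j : K, i != j -> \sum_(l < 3) c`_l * P l i * P l j = - (edge i j)%:R) ->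
  size mu = 3%N -> sorted >=%R mu -> 0 < mu`_2 ->
  (1 + (mu`_1 == mu`_0)%R + (mu`_2 == mu`_0)%R)%N = m ->
  dL_top_mult m.
Proof.
move=> P [f [inj_f nonadj_f sup_f]] diam sum_p orth_p lap.
case: mu orth_p => [|a [|b [|d []]]] //= orth_p _ /and3P[ba db _] d0 <-.
apply: (dL_core inj_f nonadj_f sup_f diam sum_p (c := fun l => c`_l)
  (mu := fun l => [:: a; b; d]`_l)) => // l l'.
by rewrite orth_p -val_eqE /=; case: (l =P l' :> nat).
Qed.

Let sum2 (F : 'I_2 -> R) :
  \sum_i F i = F (@Ordinal 2 0 isT) + F (@Ordinal 2 1 isT).
Proof. by rewrite !big_ord_recl big_ord0 addr0; congr (F _ + F _); apply: val_inj. Qed.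

Let sum3 (F : 'I_3 -> R) :
  \sum_i F i = F (@Ordinal 3 0 isT) + F (@Ordinal 3 1 isT) + F (@Ordinal 3 2 isT).
Proof.
by rewrite !big_ord_recl big_ord0 addr0 addrA; congr (F _ + F _ + F _); apply: val_inj.
Qed.

Let sum4 (F : 'I_4 -> R) :
  \sum_i F i = F (@Ordinal 4 0 isT) + F (@Ordinal 4 1 isT) + F (@Ordinal 4 2 isT)
               + F (@Ordinal 4 3 isT).
Proof.
by rewrite !big_ord_recl big_ord0 addr0 !addrA; congr (F _ + F _ + F _ + F _);
  apply: val_inj.
Qed.

Definition vec4 (x y z t : R) (i : 'I_4) : R := [:: x; y; z; t]`_i.

Definition vec32 (x y z t u : R) (i : 'I_3 + 'I_2) : R :=
  match i with inl i => [:: x; y; z]`_i | inr i => [:: t; u]`_i end.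

Definition vec222 (x y z t u v : R) (i : 'I_2 + 'I_2 + 'I_2) : R :=
  match i with
  | inl (inl i) => [:: x; y]`_i
  | inl (inr i) => [:: z; t]`_i
  | inr i => [:: u; v]`_i
  end.

Let sum32 (F : 'I_3 + 'I_2 -> R) :
  \sum_i F i = \sum_i F (inl i) + \sum_i F (inr i).
Proof. exact: big_sumType. Qed.

Let sum222 (F : 'I_2 + 'I_2 + 'I_2 -> R) :
  \sum_i F i =
  \sum_i F (inl (inl i)) + \sum_i F (inl (inr i)) + \sum_i F (inr i).
Proof. by rewrite !big_sumType. Qed.

Local Ltac split_ord := let lt := fresh in case=> -[|[|[|[|?]]]] // lt.

(* Evaluates the adjacencies between explicit vertices. *)
Local Ltac eval_edges :=
  repeat match goal with
  | |- context [@edge ?K ?i ?j] =>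
    let b := eval vm_compute in (@edge K i j) in change (@edge K i j) with b
  end.

(* The goals are, in order: a common non-neighbour, zero sums, orthogonality,
   off-diagonal entries, sortedness, positivity, multiplicity of the maximum. *)
Local Ltac check4 :=
  [> by left; rewrite card_ord
  | by split_ord; rewrite sum4 /vec4 /=; lra
  | by split_ord; split_ord; rewrite sum4 /vec4 /=; lra
  | by split_ord; split_ord; rewrite //= => _; rewrite sum3 /vec4 /=;
    eval_edges; lra
  | by rewrite /= ?andbT; lra
  | by rewrite /=; lra
  | by rewrite /= ?eqxx // !lt_eqF //; lra ].

Local Ltac split_union := case; split_ord.

Local Ltac check32 :=
  [> by split_ord; rewrite sum32 sum3 sum2 /vec32 /=; lra
  | by split_ord; split_ord; rewrite sum32 sum3 sum2 /vec32 /=; lra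
  | by split_union; split_union; rewrite //= => _; rewrite sum3 /vec32 /=;
    eval_edges; lra
  | by rewrite /= ?andbT; lra
  | by rewrite /=; lra
  | by rewrite /= ?eqxx // !lt_eqF //; lra ].

(** Any orthogonal basis of the vectors of sum zero would do. *)
Lemma dL_K4 : complement_core (complete 4) G -> dL_top_mult 3.
Proof.
move=> core; apply: (dL_complement_core (K := complete 4)
  (p := [:: vec4 1 1 (-1) (-1); vec4 1 (-1) 1 (-1); vec4 1 (-1) (-1) 1])
  (c := [:: 1; 1; 1]) (mu := [:: 4; 4; 4])
  core _ _ _ _ erefl); check4.
Qed.

Lemma dL_diamond : complement_core diamond G -> dL_top_mult 2.
Proof.
move=> core; apply: (dL_complement_core (K := diamond)
  (p := [:: vec4 1 1 (-1) (-1); vec4 0 0 1 (-1); vec4 1 (-1) 0 0])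
  (c := [:: 1; 2; 1]) (mu := [:: 4; 4; 2])
  core _ _ _ _ erefl); check4.
Qed.

Lemma dL_S4 : complement_core (star 4) G -> dL_top_mult 1.
Proof.
move=> core; apply: (dL_complement_core (K := star 4)
  (p := [:: vec4 3 (-1) (-1) (-1); vec4 0 1 (-1) 0; vec4 0 1 1 (-2)])
  (c := [:: 1 / 3; 1 / 2; 1 / 6]) (mu := [:: 4; 1; 1])
  core _ _ _ _ erefl); check4.
Qed.

Lemma dL_C4 : complement_core (cycle_graph 4) G -> dL_top_mult 1.
Proof.
move=> core; apply: (dL_complement_core (K := cycle_graph 4)
  (p := [:: vec4 1 (-1) 1 (-1); vec4 1 1 (-1) (-1); vec4 1 (-1) (-1) 1])
  (c := [:: 1; 1 / 2; 1 / 2]) (mu := [:: 4; 2; 2])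
  core _ _ _ _ erefl); check4.
Qed.

Lemma dL_paw : complement_core (kite 4 3) G -> dL_top_mult 1.
Proof.
move=> core; apply: (dL_complement_core (K := kite 4 3)
  (p := [:: vec4 1 1 (-3) 1; vec4 1 (-1) 0 0; vec4 1 1 0 (-2)])
  (c := [:: 1 / 3; 3 / 2; 1 / 6]) (mu := [:: 4; 3; 1])
  core _ _ _ _ erefl); check4.
Qed.

Lemma dL_P4 : complement_core (path_graph 4) G -> dL_top_mult 1.
Proof.
pose s : R := Num.sqrt 2.
have s_sqr : s * s = 2 by rewrite -expr2 sqr_sqrtr.
have s_gt0 : 0 < s by rewrite sqrtr_gt0.
have s_lt2 : s < 2 by nra.
clearbody s; move=> core; apply: (dL_complement_core (K := path_graph 4)
  (p := [:: vec4 1 (- (1 + s)) (1 + s) (-1); vec4 1 (-1) (-1) 1;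
           vec4 1 (s - 1) (1 - s) (-1)])
  (c := [:: 1 / 4; 1 / 2; 1 / 4]) (mu := [:: 2 + s; 2; 2 - s])
  core _ _ _ _ erefl); check4.
Qed.

Lemma dL_K3_K2 : complement_core (complete 3 \+g complete 2) G -> dL_top_mult 2.
Proof.
move=> core; apply: (dL_complement_core (K := complete 3 \+g complete 2)
  (p := [:: vec32 1 (-1) 0 0 0; vec32 1 1 (-2) 0 0; vec32 0 0 0 1 (-1)])
  (c := [:: 3 / 2; 1 / 2; 1]) (mu := [:: 3; 3; 2])
  core
  (or_intror (@common_non_neighbor_union (complete 3) (complete 2)
    (@Ordinal 3 0 isT) (@Ordinal 2 0 isT))) _ _ _ erefl); check32.
Qed.

Lemma dL_P3_K2 : complement_core (star 3 \+g complete 2) G -> dL_top_mult 1.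
Proof.
move=> core; apply: (dL_complement_core (K := star 3 \+g complete 2)
  (p := [:: vec32 2 (-1) (-1) 0 0; vec32 0 0 0 1 (-1); vec32 0 1 (-1) 0 0])
  (c := [:: 1 / 2; 1; 1 / 2]) (mu := [:: 3; 2; 1])
  core
  (or_intror (@common_non_neighbor_union (star 3) (complete 2)
    (@Ordinal 3 0 isT) (@Ordinal 2 0 isT))) _ _ _ erefl); check32.
Qed.

Lemma dL_matching3 : complement_core matching3 G -> dL_top_mult 3.
Proof.
move=> core; apply: (dL_complement_core (K := matching3)
  (p := [:: vec222 1 (-1) 0 0 0 0; vec222 0 0 1 (-1) 0 0; vec222 0 0 0 0 1 (-1)])
  (c := [:: 1; 1; 1]) (mu := [:: 2; 2; 2]) core
  (or_intror (@common_non_neighbor_union (complete 2 \+g complete 2) (complete 2)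
    (inl (@Ordinal 2 0 isT)) (@Ordinal 2 0 isT))) _ _ _ erefl).
- by split_ord; rewrite sum222 !sum2 /vec222 /=; lra.
- by split_ord; split_ord; rewrite sum222 !sum2 /vec222 /=; lra.
- by case=> [[]|]; split_ord; case=> [[]|]; split_ord; rewrite //= => _;
    rewrite sum3 /vec222 /=; eval_edges; lra.
- by rewrite /= !lexx.
- by rewrite /=; lra.
- by rewrite /= eqxx.
Qed.
End Spectra.

(** * The theorem *)

Section Main.
Variables (R : rcfType) (G : sgraph).
Local Notation n := #|G|.
Hypothesis n_ge5 : (5 <= n)%N.

Lemma iso_complement_core (K H : sgraph) :
  #|H| = n -> complement_core K H -> G ~=g H <-> complement_core K G.
Proof.
move=> cardH coreH; split=> [isoGH | coreG].
  exact: complement_core_iso isoGH coreH.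
exact: complement_core_unique (esym cardH) coreG coreH.
Qed.

Lemma leq_card_core (K : sgraph) : complement_core K G -> (#|K| <= n)%N.
Proof. by case=> f [inj_f _ _]; apply: leq_card inj_f. Qed.

Lemma rank_of_eig_mult : dL_eig R G n.-1 = n%:R -> dL_mult R G n.-1 = (n - 4)%N ->
  \rank (shifted_laplacian R G) = 4%N.
Proof.
rewrite /dL_mult => ->; rewrite /eig_mult mup_char_poly_sym; last first.
  have := shifted_laplacian_sym R G.
  by rewrite /shifted_laplacian linearB /= tr_scalar_mx => /addIr.
rewrite -/(shifted_laplacian R G); have := rank_leq_row (shifted_laplacian R G).
move: (\rank _) => r; lia.
Qed.

Lemma core_of_rank : \rank (shifted_laplacian R G) = 4%N ->
  [\/ core_mult3 G, core_mult2 G | core_mult1 G].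
Proof.
move=> rank4; apply: (@core_classification R) => es.
  move=> /(rank_shifted_laplacian_ge R); rewrite rank4; apply.
  exact: leq_trans n_ge5.
by move=> /rank_shifted_laplacian_le; rewrite rank4.
Qed.

Lemma core_mult3P : core_mult3 G -> dL_top_mult R G 3.
Proof. by case; [apply: dL_K4 | apply: dL_matching3]. Qed.

Lemma core_mult2P : core_mult2 G -> dL_top_mult R G 2.
Proof. by case; [apply: dL_diamond | apply: dL_K3_K2]. Qed.

Lemma core_mult1P : core_mult1 G -> dL_top_mult R G 1.
Proof.
by case=> [||| []]; [apply: dL_S4 | apply: dL_C4 | apply: dL_P4 | apply: dL_paw
  | apply: dL_P3_K2].
Qed.

(** The core determines the multiplicity of the largest eigenvalue, and that
    multiplicity differs between the three groups of cores. *)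
Lemma dL_top_multP :
  [/\ dL_top_mult R G 3 <-> core_mult3 G, dL_top_mult R G 2 <-> core_mult2 G
    & dL_top_mult R G 1 <-> core_mult1 G].
Proof.
have cases m : dL_top_mult R G m -> [\/ core_mult3 G, core_mult2 G | core_mult1 G].
  by case=> _ eig_n mult_n; apply: core_of_rank; apply: rank_of_eig_mult.
have top_uniq m m' : dL_top_mult R G m -> dL_top_mult R G m' -> m = m'.
  by case=> <- _ _ [<-].
have [top3 top2 top1] := And3 core_mult3P core_mult2P core_mult1P.
split; split=> // topm; case: (cases _ topm) => // core;
  first [ by have := top_uniq _ _ topm (top3 core)
        | by have := top_uniq _ _ topm (top2 core)
        | by have := top_uniq _ _ topm (top1 core) ].
Qed.

Lemma core_mult3_iso : core_mult3 G <->
  G ~=g complete_multipartite (4%N :: nseq (n - 4) 1%N) \/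
  (6 <= n)%N /\
  G ~=g complete_multipartite ([:: 2; 2; 2]%N ++ nseq (n - 6) 1%N).
Proof.
have isoK4 : G ~=g complete_multipartite (4%N :: nseq (n - 4) 1%N) <->
    complement_core (complete 4) G.
  apply: iso_complement_core (core_K4 _).
  by rewrite card_multipartite /= sumn_nseq mul1n subnKC // ltnW.
have isoM : (6 <= n)%N ->
    G ~=g complete_multipartite ([:: 2; 2; 2]%N ++ nseq (n - 6) 1%N) <->
    complement_core matching3 G.
  move=> n_ge6; apply: iso_complement_core (core_matching3 _).
  by rewrite card_multipartite sumn_cat sumn_nseq mul1n subnKC.
split=> [[coreG|coreG]|[/isoK4|[n_ge6 /(isoM n_ge6)]]]; [| |by left|by right].
  by left; apply/isoK4.
have n_ge6 : (6 <= n)%N.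
  by have := leq_card_core coreG; rewrite !card_sum !card_ord.
by right; split=> //; apply/isoM.
Qed.

Lemma core_mult2_iso : core_mult2 G <->
  is_plus_edge G (complete_split n 4) \/
  G ~=g complete_multipartite ([:: 3; 2]%N ++ nseq (n - 5) 1%N).
Proof.
have isoK : G ~=g complete_multipartite ([:: 3; 2]%N ++ nseq (n - 5) 1%N) <->
    complement_core (complete 3 \+g complete 2) G.
  apply: iso_complement_core (core_K3_K2 _).
  by rewrite card_multipartite sumn_cat sumn_nseq mul1n subnKC.
have card_S : #|complete_split n 4| = n.
  by rewrite card_complement_isolated card_ord subnKC // ltnW.
split=> [[coreG|/isoK isoG]|[[a [b [neq_ab nab isoG]]]|/isoK]]; [|by right| |by right].
  left; pose a : complete_split n 4 := inl (@Ordinal 4 0 isT).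
  pose b : complete_split n 4 := inl (@Ordinal 4 1 isT).
  exists a, b; have nab : nonadj a b by rewrite nonadj_complement.
  case/andP: nab => neq_ab nab; split=> //.
  have card_ab : #|add_edge a b| = n by exact: card_S.
  exact: (iso_complement_core card_ab (core_add_edge neq_ab nab)).2.
by left; apply: complement_core_iso isoG (core_add_edge neq_ab nab).
Qed.

Lemma core_mult1_iso : core_mult1 G <->
  [\/ G ~=g complement (star 4 \+g edgeless (n - 4)),
      G ~=g complement (cycle_graph 4 \+g edgeless (n - 4)),
      G ~=g complement (path_graph 4 \+g edgeless (n - 4))
    | G ~=g complement (kite 4 3 \+g edgeless (n - 4)) \/
      G ~=g complement (star 3 \+g complete 2 \+g edgeless (n - 5))].
Proof.
have iso4 (e : rel 'I_4) : G ~=g complement (mk_graph e \+g edgeless (n - 4)) <->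
    complement_core (mk_graph e) G.
  by apply: iso_complement_isolated; rewrite card_ord subnKC // ltnW.
have iso5 : G ~=g complement (star 3 \+g complete 2 \+g edgeless (n - 5)) <->
    complement_core (star 3 \+g complete 2) G.
  by apply: iso_complement_isolated; rewrite card_sum !card_ord subnKC.
rewrite /core_mult1 /star /cycle_graph /path_graph /kite -!/(star 3) in iso4 iso5 *.
by split=> -[/iso4|/iso4|/iso4|[/iso4|/iso5]] core;
  first [exact: Or41 core | exact: Or42 core | exact: Or43 core
        | exact: (Or44 _ _ _ (or_introl core))
        | exact: (Or44 _ _ _ (or_intror core))].
Qed.
End Main.

Theorem theorem4p3 (R : rcfType) (n : nat) (G : sgraph)
    (n_ge5 : (5 <= n)%N) (order_G : #|G| = n) (conn_G : connected G) :
  [/\ [/\ dL_mult R G 1 = 3%N,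
          dL_eig R G n.-1 = n%:R & dL_mult R G n.-1 = (n - 4)%N]
      <->
      G ~=g complete_multipartite (4%N :: nseq (n - 4) 1%N) \/
      (6 <= n)%N /\
      G ~=g complete_multipartite ([:: 2; 2; 2]%N ++ nseq (n - 6) 1%N),

      [/\ dL_mult R G 1 = 2%N,
          dL_eig R G n.-1 = n%:R & dL_mult R G n.-1 = (n - 4)%N]
      <->
      is_plus_edge G (complete_split n 4) \/
      G ~=g complete_multipartite ([:: 3; 2]%N ++ nseq (n - 5) 1%N)

    & [/\ dL_mult R G 1 = 1%N,
          dL_eig R G n.-1 = n%:R & dL_mult R G n.-1 = (n - 4)%N]
      <->
      [\/ G ~=g complement (star 4 \+g edgeless (n - 4)),
          G ~=g complement (cycle_graph 4 \+g edgeless (n - 4)),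
          G ~=g complement (path_graph 4 \+g edgeless (n - 4))
        | G ~=g complement (kite 4 3 \+g edgeless (n - 4)) \/
          G ~=g complement (star 3 \+g complete 2 \+g edgeless (n - 5))]].
Proof.
subst n; have [top3 top2 top1] := dL_top_multP R n_ge5; split.
- exact: iff_trans top3 (core_mult3_iso n_ge5).
- exact: iff_trans top2 (core_mult2_iso n_ge5).
- exact: iff_trans top1 (core_mult1_iso n_ge5).
Qed.
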